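(* Duality $\lambda\mapsto\lambda'$ maps the set of all integral solutions in $\mathcal{E}^{*-}$ bijectively onto itself, and reciprocity $\lambda\mapsto\check\lambda$ maps the set of all integral solutions in $\mathcal{E}^{*-}$ bijectively onto the set of all integral solutions in $\mathcal{E}^{-*}$.
   Context: A data is a tuple $\lambda=(p,q,r;a,b;x)$, and $f(w;\lambda):={}_2F_1(pw+a,\,qw+b;\,rw;\,x)$ (Gauss hypergeometric series), a meromorphic function of $w\in\mathbb{C}$. A data is integral if $(p,q,r)\in\mathbb{Z}^3$. Problem I asks for $\lambda$ such that, for some $C,d\in\mathbb{C}^\times$, $m,n\in\mathbb{Z}_{\ge0}$ and $u_1,\dots,u_m,v_1,\dots,v_n\in\mathbb{C}$, one has $f(w;\lambda)=C\,d^w\,\Gamma(w+u_1)\cdots\Gamma(w+u_m)/(\Gamma(w+v_1)\cdots\Gamma(w+v_n))$. Problem II asks for $\lambda$ such that $f(w+1;\lambda)/f(w;\lambda)$ is a rational function of $w$. $\mathcal{E}^{*-}:=\{\lambda\in\mathbb{R}^6: 0<p<r,\ q<0,\ r>0;\ a,b\in\mathbb{R};\ 0<x<1\}$ and $\mathcal{E}^{-*}:=\{\lambda\in\mathbb{R}^6: p<0,\ 0<q<r,\ r>0;\ a,b\in\mathbb{R};\ 0<x<1\}$. On these regions Problems I and II are known (earlier work) to be equivalent, and a solution means a solution to either one. Duality: $\lambda\mapsto\lambda'=(p,q,r;a',b';x)$ with $a':=1-\frac{2p}{r}-a$, $b':=1-\frac{2q}{r}-b$. Reciprocity: $\lambda\mapsto\check\lambda=(\check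 p,\check q,\check r;\check a,\check b;\check x)$ with $\check p:=-p$, $\check q:=-q$, $\check r:=r-p-q$, $\check x:=1-x$, $\check a:=\frac{(r-q)(1-a)-pb}{r-p-q}$, $\check b:=\frac{(r-p)(1-b)-qa}{r-p-q}$. *)

(* Defs.v *)
From HB Require Import structures.
From mathcomp Require Import all_boot all_order all_algebra.
From mathcomp Require Import all_classical all_reals all_analysis.
From mathcomp.real_closed Require Import complex.

Set Implicit Arguments.
Unset Strict Implicit.
Unset Printing Implicit Defensive.

Import Order.TTheory GRing.Theory Num.Theory.
Import numFieldNormedType.Exports.

Local Open Scope classical_set_scope.
Local Open Scope ring_scope.
Local Open Scope complex_scope.

(* The numClosedFieldType R[i], named so that MathComp-Analysis finds the
   topology induced by its norm: no topology is declared on R[i] itself. *)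
Definition Cplx (R : realType) : numClosedFieldType := R[i].

Definition ofR (R : realType) (x : R) : Cplx R := x%:C.

Definition cexp (R : realType) (z : Cplx R) : Cplx R :=
  (expR (complex.Re z) * cos (complex.Im z))
    +i* (expR (complex.Re z) * sin (complex.Im z)).

(* The poles of Gamma: 0, -1, -2, ... *)
Definition nonpos_integer (R : realType) (z : Cplx R) : Prop :=
  exists k : nat, z = - k%:R.

(* Gauss's product, with n^z = exp (z log n):
     Gamma z = lim_n n! n^z / (z (z + 1) ... (z + n)).
   Meaningful only where z is not a nonpositive integer. *)
Definition Gamma (R : realType) (z : Cplx R) : Cplx R :=
  limn (fun n : nat =>
    (n`!)%:R * cexp (z * ofR (ln n%:R)) / \prod_(0 <= k < n.+1) (z + k%:R)).

(* The rising factorial a (a + 1) ... (a + n - 1). *)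
Definition pochhammer (R : realType) (a : Cplx R) (n : nat) : Cplx R :=
  \prod_(0 <= k < n) (a + k%:R).

(* The sum of the Gauss series. Meaningful only where c is not a nonpositive
   integer and the series converges, in particular for `|x| < 1. *)
Definition hyp2F1 (R : realType) (a b c x : Cplx R) : Cplx R :=
  limn (series (fun n : nat =>
    pochhammer a n * pochhammer b n / (pochhammer c n * (n`!)%:R) * x ^+ n)).

Record data (R : realType) := Data {
  dp : R; dq : R; dr : R; da : R; db : R; dx : R }.

Definition integral_data (R : realType) (l : data R) : Prop :=
  [/\ dp l \is a Num.int, dq l \is a Num.int & dr l \is a Num.int].

Definition hypf (R : realType) (l : data R) (w : Cplx R) : Cplx R :=
  hyp2F1 (ofR (dp l) * w + ofR (da l)) (ofR (dq l) * w + ofR (db l))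
         (ofR (dr l) * w) (ofR (dx l)).

(* The points w where the series defining hypf l w makes sense. *)
Definition regular_at (R : realType) (l : data R) (w : Cplx R) : Prop :=
  ~ nonpos_integer (ofR (dr l) * w).

(* An identity of meromorphic functions is stated, here and in problemII, as
   the equality of values wherever every expression in it is defined; the
   points left out form a discrete set as long as hypf l is not identically 0.
   d^w is exp (w * logd) for some determination logd of log d. *)
Definition problemI (R : realType) (l : data R) : Prop :=
  exists (C d logd : Cplx R) (m n : nat)
         (u : 'I_m -> Cplx R) (v : 'I_n -> Cplx R),
  [/\ C != 0, d != 0, cexp logd = d &
    forall w : Cplx R,
      regular_at l w ->
      (forall i, ~ nonpos_integer (w + u i)) ->
      (forall j, ~ nonpos_integer (w + v j)) ->
      hypf l w = C * cexp (w * logd) *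
        (\prod_i Gamma (w + u i) / \prod_j Gamma (w + v j))].

Definition problemII (R : realType) (l : data R) : Prop :=
  exists P Q : {poly Cplx R}, Q != 0 /\
    forall w : Cplx R,
      regular_at l w -> regular_at l (w + 1) -> hypf l w != 0 -> Q.[w] != 0 ->
      hypf l (w + 1) / hypf l w = P.[w] / Q.[w].

Definition solution (R : realType) (l : data R) : Prop :=
  problemI l \/ problemII l.

(* The regions E^{*-} and E^{-*}, in this order. *)
Definition Estarminus (R : realType) : set (data R) :=
  [set l | [/\ 0 < dp l < dr l, dq l < 0, 0 < dr l & 0 < dx l < 1]].

Definition Eminusstar (R : realType) : set (data R) :=
  [set l | [/\ dp l < 0, 0 < dq l < dr l, 0 < dr l & 0 < dx l < 1]].

Definition integral_solutions_in (R : realType) (E : set (data R)) :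
    set (data R) :=
  [set l | [/\ E l, integral_data l & solution l]].

Definition duality (R : realType) (l : data R) : data R :=
  let: Data p q r a b x := l in
  Data p q r (1 - 2 * p / r - a) (1 - 2 * q / r - b) x.

Definition reciprocity (R : realType) (l : data R) : data R :=
  let: Data p q r a b x := l in
  Data (- p) (- q) (r - p - q)
       (((r - q) * (1 - a) - p * b) / (r - p - q))
       (((r - p) * (1 - b) - q * a) / (r - p - q))
       (1 - x).

(* Main.v *)
Require Import Defs.
From mathcomp Require Import all_boot all_order all_algebra.
From mathcomp Require Import all_classical all_reals all_analysis.
From HB Require Import structures.
From mathcomp.real_closed Require Import complex polyrcf.
From mathcomp Require Import zify ring lra.

(** Write [F(w)] for the series of the data at [w] and [G(w)] for its image under
    [theta = x d/dx]. Since [p], [q], [r] are integers, the contiguity relations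
    give [D(w) (F, G)(w + 1) = N(w) (F, G)(w)] with a polynomial [D] and a
    polynomial two-by-two matrix [N] ([contiguity], [unit_mx]). The heart of the
    proof is that, for [0 < p < r] and [q < 0], a solution to either problem forces
    the upper right entry [N12], the coefficient of [G], to vanish identically
    ([solution_m12]); the converse is immediate ([m12_solution]). The condition
    [N12 = 0] is algebraic, concerns all the solutions of the hypergeometric
    equation at once, and is therefore carried over by the symmetries of that
    equation.

    Symmetries. The function [x^(1-c) (1-x)^(c-a-b) h] solves the equation with
    parameters [(a, b, c)] if [h(x)] has the parameters [(1-a, 1-b, 2-c)], or if [h]
    is a function of [1-x] with the parameters [(1-a, 1-b, 1+c-a-b)]. Along the
    line [(pw+a, qw+b, rw)] the former are the parameters of the dual data at
    [2/r - w], the latter those of the reciprocal data at [w + (1-a-b)/(r-p-q)].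
    The corresponding changes of coordinates are lower triangular, so that
    they preserve the vanishing of the upper right entry ([dual_m12],
    [recip_m12]). Exchanging [a] and [b], which does not affect the series, brings
    the reciprocal data back to the region [0 < p < r], [q < 0], so that this
    region is the only one to be studied.

    Why [N12 = 0] ([rational_ratio_m12]). By the functional equation of [Gamma],
    solutions to either problem satisfy [Q(w) F(w+1) = P(w) F(w)] for large real
    [w], with real polynomials and [Q] nonzero. Suppose that [N12] is not zero.
    Then [G / F] is rational, so that [(F, G) = k (S, T)] with [S], [T] coprime
    polynomials, and [N (S, T)(w) = mu(w) (S, T)(w+1)] for a polynomial [mu], whence
    [k(w+1) / k(w) = mu(w) / D(w)]. As [w] tends to [+oo], [F] grows at most
    exponentially ([gauss_le]), so that [mu] has at most the degree of [D]. Now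
    go down to a real point [c] far to the left. All the roots of [D] are real,
    and the multiplicity of the roots of [mu] in the class of [c] modulo the
    integers, minus that of the roots of [D], is the order of the pole of [(F, G)]
    at [c]. This order is nonnegative, and it is positive if [rc] is an integer
    and [pc+a] is not ([not_rightO]): approaching [c] from the right, one raises
    the first and then the third parameter until they are nonnegative, which never
    meets a vanishing factor, and arrives at a series with nonnegative terms and
    constant term 1. Adding up over the classes ([count_roots]), the degree of
    [mu] exceeds that of [D], a contradiction. *)

Set Implicit Arguments.
Unset Strict Implicit.
Unset Printing Implicit Defensive.

Import Order.TTheory GRing.Theory Num.Theory.
Import numFieldNormedType.Exports.
Import Normc.

Local Open Scope ring_scope.

(** * Contiguity matrices *)

(** Elementary shifts of the parameters [(a, b, c)] of a Gauss series:
    [Sa] is [a + 1], [Sb] is [b - 1], [Sc] is [c + 1] and [Sg] is [c - 1]. *)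
Inductive step := Sa | Sb | Sc | Sg.

Section ContiguityMatrices.
Variable A : comNzRingType.
Implicit Types (x y : A) (ws : seq step).

(** Two-by-two matrices, given by their four entries: identities between them
    then reduce to four instances of [ring]. *)
Record mat2 := Mat2 { m11 : A; m12 : A; m21 : A; m22 : A }.

Definition mul2 (M N : mat2) := Mat2
  (m11 M * m11 N + m12 M * m21 N) (m11 M * m12 N + m12 M * m22 N)
  (m21 M * m11 N + m22 M * m21 N) (m21 M * m12 N + m22 M * m22 N).
Definition scale2 (k : A) (M : mat2) :=
  Mat2 (k * m11 M) (k * m12 M) (k * m21 M) (k * m22 M).
Definition adj2 (M : mat2) := Mat2 (m22 M) (- m12 M) (- m21 M) (m11 M).
Definition det2 (M : mat2) := m11 M * m22 M - m12 M * m21 M.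
Definition id2 := Mat2 1 0 0 1.

(** The parameters [(a, b, c)] of the hypergeometric equation. *)
Record par := Par { pa : A; pb : A; pc : A }.

Definition pshift (s : step) (z : par) : par :=
  match s with
  | Sa => Par (pa z + 1) (pb z) (pc z)
  | Sb => Par (pa z) (pb z - 1) (pc z)
  | Sc => Par (pa z) (pb z) (pc z + 1)
  | Sg => Par (pa z) (pb z) (pc z - 1)
  end.

(** The operator [(1 - x) (theta + y)], with [theta = x d/dx], on the solutions
    of the hypergeometric equation with parameters [z], in the coordinates
    [(f, theta f)]; the second derivative is eliminated by the equation. *)
Definition theta_mx x y (z : par) : mat2 := Mat2
  ((1 - x) * y) (1 - x)
  (pa z * pb z * x) ((1 - x) * y + (pa z + pb z) * x - (pc z - 1)).

(** The contiguity relation of the step [s] at [z] is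
    [den x s z * Y (pshift s z) = mat x s z * Y z], where [Y = (f, theta f)].
    For [Sa] and [Sg] it is the action of [theta + a] and [theta + c - 1]; for
    [Sb] and [Sc] it is obtained by inverting such an action. *)
Definition den x (s : step) (z : par) : A :=
  match s with
  | Sa => (1 - x) * pa z
  | Sb => (pb z - 1) * (pb z - pc z)
  | Sc => - (x * ((pc z - pa z) * (pc z - pb z)))
  | Sg => (1 - x) * (pc z - 1)
  end.

Definition mat x (s : step) (z : par) : mat2 :=
  match s with
  | Sa => theta_mx x (pa z) z
  | Sb => scale2 (pb z - 1) (adj2 (theta_mx x (pb z - 1) (pshift Sb z)))
  | Sc => scale2 (pc z) (adj2 (theta_mx x (pc z) (pshift Sc z)))
  | Sg => theta_mx x (pc z - 1) z
  end.

(** A list of steps is performed from its head on: [pshifts], [dens] and [mats]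
    give the final parameters and the composite contiguity relation
    [dens x ws z * Y (pshifts ws z) = mats x ws z * Y z]. *)
Fixpoint pshifts ws z : par :=
  if ws is s :: ws' then pshifts ws' (pshift s z) else z.

Fixpoint dens x ws z : A :=
  if ws is s :: ws' then dens x ws' (pshift s z) * den x s z else 1.

Fixpoint mats x ws z : mat2 :=
  if ws is s :: ws' then mul2 (mats x ws' (pshift s z)) (mat x s z) else id2.

Lemma mat2_eq (M N : mat2) : m11 M = m11 N -> m12 M = m12 N ->
  m21 M = m21 N -> m22 M = m22 N -> M = N.
Proof. by case: M; case: N => /= ? ? ? ? ? ? ? ? -> -> -> ->. Qed.

Lemma mul2A M N P : mul2 M (mul2 N P) = mul2 (mul2 M N) P.
Proof. by apply: mat2_eq => /=; ring. Qed.

Lemma mul2_1 M : mul2 M id2 = M.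
Proof. by apply: mat2_eq => /=; ring. Qed.

Lemma mul1_2 M : mul2 id2 M = M.
Proof. by apply: mat2_eq => /=; ring. Qed.

Lemma scale2Ml k M N : mul2 (scale2 k M) N = scale2 k (mul2 M N).
Proof. by apply: mat2_eq => /=; ring. Qed.

Lemma scale2Mr k M N : mul2 M (scale2 k N) = scale2 k (mul2 M N).
Proof. by apply: mat2_eq => /=; ring. Qed.

Lemma scale2A k l M : scale2 k (scale2 l M) = scale2 (k * l) M.
Proof. by apply: mat2_eq => /=; ring. Qed.

Lemma det2M M N : det2 (mul2 M N) = det2 M * det2 N.
Proof. by rewrite /det2 /=; ring. Qed.

Lemma shifts_cat ws1 ws2 z : pshifts (ws1 ++ ws2) z = pshifts ws2 (pshifts ws1 z).
Proof. by elim: ws1 z => //= s ws1 IH z; rewrite IH. Qed.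

Lemma mats_cat x ws1 ws2 z :
  mats x (ws1 ++ ws2) z = mul2 (mats x ws2 (pshifts ws1 z)) (mats x ws1 z).
Proof.
elim: ws1 z => [|s ws1 IH] z /=; first by rewrite mul2_1.
by rewrite IH mul2A.
Qed.

(** The determinants of the matrices [mat], in factored form. *)
Definition det_mat x (s : step) (z : par) : A :=
  match s with
  | Sa => (1 - x) * pa z * (pa z - pc z + 1)
  | Sb => (pb z - 1) ^+ 2 * ((1 - x) * (pb z - 1) * (pb z - pc z))
  | Sc => pc z ^+ 2 * (- ((1 - x) * x * (pc z - pa z) * (pc z - pb z)))
  | Sg => - ((1 - x) * x * (pc z - 1 - pa z) * (pc z - 1 - pb z))
  end.

Lemma det_matE x s z : det2 (mat x s z) = det_mat x s z.
Proof. by case: s; rewrite /det2 /=; ring. Qed.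

(** ** Duality *)

(** The parameters of the hypergeometric equation solved by [h] when
    [x^(1-c) (1-x)^(c-a-b) h] solves the one with parameters [z]. *)
Definition dual_par (z : par) : par := Par (1 - pa z) (1 - pb z) (2 - pc z).

(** The change of coordinates [(h, theta h) -> (f, theta f)] for
    [f = x^(1-c) (1-x)^(c-a-b) h], multiplied by [1 - x] and divided by
    [x^(1-c) (1-x)^(c-a-b)]. It is lower triangular, so that it does not affect
    the vanishing of upper right entries. *)
Definition gauge x (z : par) : mat2 := Mat2
  (1 - x) 0
  ((1 - pc z) * (1 - x) - (pc z - pa z - pb z) * x) (1 - x).

(** The factor of proportionality in [dual_step]; the value at [Sg] is not
    used. *)
Definition dual_scalar x (s : step) (z : par) : A :=
  match s with
  | Sa => - ((1 - x) * pa z * (pa z - pc z + 1))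
  | Sb => (1 - x) * (pb z - 1) ^+ 3 * (pb z - pc z)
  | Sc => - ((1 - x) * x * pc z * (pc z - 1) * (pc z - pa z) * (pc z - pb z))
  | Sg => 0
  end.

(** The dual of a step goes backwards: it is the same kind of step, from
    [dual_par (pshift s z)] to [dual_par z]. *)
Lemma dual_step x s z : s <> Sg ->
  mul2 (mul2 (mat x s z) (gauge x z)) (mat x s (dual_par (pshift s z))) =
  scale2 (dual_scalar x s z) (gauge x (pshift s z)).
Proof. by case: s => // _; apply: mat2_eq => /=; ring. Qed.

Fixpoint dual_scalars x ws z : A :=
  if ws is s :: ws' then dual_scalars x ws' (pshift s z) * dual_scalar x s z
  else 1.

Lemma dual_shift s z : s <> Sg -> pshift s (dual_par (pshift s z)) = dual_par z.
Proof. by case: s => // _; rewrite /dual_par /=; congr Par; ring. Qed.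

Fixpoint no_Sg ws : bool :=
  if ws is s :: ws' then (if s is Sg then false else true) && no_Sg ws'
  else true.

Lemma dual_shifts ws z : no_Sg ws ->
  pshifts (rev ws) (dual_par (pshifts ws z)) = dual_par z.
Proof.
elim: ws z => [|s ws IH] z //= /andP[hs hws].
rewrite rev_cons -cats1 shifts_cat IH //= dual_shift //.
by case: s hs.
Qed.

(** The dual of a chain of steps is the same chain read backwards. *)
Lemma dual_steps x ws z : no_Sg ws ->
  mul2 (mul2 (mats x ws z) (gauge x z))
       (mats x (rev ws) (dual_par (pshifts ws z))) =
  scale2 (dual_scalars x ws z) (gauge x (pshifts ws z)).
Proof.
elim: ws z => [|s ws IH] z /=.
  by move=> _; apply: mat2_eq => /=; ring.
move=> /andP[hs hws]; have hs' : s <> Sg by case: s hs.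
rewrite rev_cons -cats1 mats_cat dual_shifts //= mul1_2.
set M := mats x ws _; set T := gauge x z; set B := mats x (rev ws) _.
have -> : mul2 (mul2 (mul2 M (mat x s z)) T)
    (mul2 (mat x s (dual_par (pshift s z))) B) =
    mul2 (mul2 M (mul2 (mul2 (mat x s z) T) (mat x s (dual_par (pshift s z))))) B.
  by rewrite !mul2A.
by rewrite dual_step // scale2Mr scale2Ml IH // scale2A mulrC.
Qed.

(** ** Reciprocity, composed with the exchange of [a] and [b] *)

(** The parameters of the hypergeometric equation in the variable [1 - x] solved
    by [h] when [x^(1-c) (1-x)^(c-a-b) h(1-x)] solves the one with parameters
    [z]. *)
Definition recip_par (z : par) : par :=
  Par (1 - pb z) (1 - pa z) (1 + pc z - pa z - pb z).

(** As [gauge], for [f = x^(1-c) (1-x)^(c-a-b) h(1-x)]; the coordinates of [h]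
    are [(h, y dh/dy)] at [y = 1 - x], whence the entry [- x]. *)
Definition gauge1 x (z : par) : mat2 := Mat2
  (1 - x) 0
  ((1 - pc z) * (1 - x) - (pc z - pa z - pb z) * x) (- x).

(** The steps from [recip_par z] to [recip_par (pshift s z)]. *)
Definition recip_step (s : step) : seq step :=
  match s with
  | Sa => [:: Sg; Sb]
  | Sb => [:: Sa; Sc]
  | Sc => [:: Sc]
  | Sg => [:: Sg]
  end.

(** The factors of proportionality in [recip_step_mat]; the values at [Sg] are
    not used. *)
Definition recip_scalar1 x (s : step) (z : par) : A :=
  match s with
  | Sa => - (x * pa z * (pc z - pb z - 1))
  | Sb => x * (1 + pc z - pa z - pb z) * (pc z - pa z - 1)
  | Sc => - (1 + pc z - pa z - pb z)
  | Sg => 0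
  end.

Definition recip_scalar2 (s : step) (z : par) : A :=
  match s with
  | Sa => 1
  | Sb => pb z - 1
  | Sc => pc z
  | Sg => 0
  end.

Lemma recip_step_mat x s z : s <> Sg ->
  scale2 (recip_scalar1 x s z) (mul2 (mat x s z) (gauge1 x z)) =
  scale2 (recip_scalar2 s z)
    (mul2 (gauge1 x (pshift s z)) (mats (1 - x) (recip_step s) (recip_par z))).
Proof. case: s => // _; apply: mat2_eq => /=; ring. Qed.

Definition recip_word ws : seq step := flatten (map recip_step ws).

Lemma recip_shift s z : s <> Sg ->
  pshifts (recip_step s) (recip_par z) = recip_par (pshift s z).
Proof. by case: s => // _; rewrite /recip_par /=; congr Par; ring. Qed.

Lemma recip_shifts ws z : no_Sg ws ->
  pshifts (recip_word ws) (recip_par z) = recip_par (pshifts ws z).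
Proof.
elim: ws z => [|s ws IH] z //= /andP[hs hws].
by rewrite /recip_word /= shifts_cat recip_shift ?IH//; case: s hs.
Qed.

Fixpoint recip_scalars1 x ws z : A :=
  if ws is s :: ws' then recip_scalars1 x ws' (pshift s z) * recip_scalar1 x s z
  else 1.

Fixpoint recip_scalars2 ws z : A :=
  if ws is s :: ws' then recip_scalars2 ws' (pshift s z) * recip_scalar2 s z
  else 1.

Lemma recip_steps x ws z : no_Sg ws ->
  scale2 (recip_scalars1 x ws z) (mul2 (mats x ws z) (gauge1 x z)) =
  scale2 (recip_scalars2 ws z)
    (mul2 (gauge1 x (pshifts ws z)) (mats (1 - x) (recip_word ws) (recip_par z))).
Proof.
elim: ws z => [|s ws IH] z /=.
  by move=> _; rewrite mul2_1 mul1_2.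
move=> /andP[hs hws]; have hs' : s <> Sg by case: s hs.
rewrite /recip_word /= mats_cat recip_shift // -/(recip_word ws).
have -> : scale2 (recip_scalars1 x ws (pshift s z) * recip_scalar1 x s z)
    (mul2 (mul2 (mats x ws (pshift s z)) (mat x s z)) (gauge1 x z)) =
  scale2 (recip_scalars1 x ws (pshift s z)) (mul2 (mats x ws (pshift s z))
    (scale2 (recip_scalar1 x s z) (mul2 (mat x s z) (gauge1 x z)))).
  by rewrite scale2Mr scale2A mul2A.
rewrite recip_step_mat // scale2Mr scale2A mulrC [mul2 (mats x ws _) _]mul2A.
rewrite -[LHS]scale2A -[scale2 (recip_scalars1 _ _ _) _]scale2Ml IH //.
by rewrite scale2Ml !scale2A mulrC -!mul2A.
Qed.

End ContiguityMatrices.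

(** ** Compatibility with ring morphisms *)

Section ContiguityMorphism.
Variables (A B : comNzRingType) (f : {rmorphism A -> B}).

Definition map_par (z : par A) : par B := Par (f (pa z)) (f (pb z)) (f (pc z)).
Definition map_mat2 (M : mat2 A) : mat2 B :=
  Mat2 (f (m11 M)) (f (m12 M)) (f (m21 M)) (f (m22 M)).

Lemma map_pshift s z : map_par (pshift s z) = pshift s (map_par z).
Proof. by case: s; rewrite /map_par /= ?rmorphB ?rmorphD ?rmorph1. Qed.

Lemma map_pshifts ws z : map_par (pshifts ws z) = pshifts ws (map_par z).
Proof. by elim: ws z => //= s ws IH z; rewrite IH map_pshift. Qed.

Lemma map_den x s z : f (den x s z) = den (f x) s (map_par z).
Proof.
by case: s; rewrite /= ?rmorphN ?rmorphM ?rmorphB ?rmorphM ?rmorphB ?rmorph1.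
Qed.

Lemma map_mat x s z : map_mat2 (mat x s z) = mat (f x) s (map_par z).
Proof.
by case: s; apply: mat2_eq => /=;
  do 4! rewrite ?rmorphN ?rmorphM ?rmorphD ?rmorph1.
Qed.

Lemma map_dens x ws z : f (dens x ws z) = dens (f x) ws (map_par z).
Proof.
elim: ws z => [|s ws IH] z /=; first exact: rmorph1.
by rewrite rmorphM IH map_den map_pshift.
Qed.

Lemma map_mul2 M N : map_mat2 (mul2 M N) = mul2 (map_mat2 M) (map_mat2 N).
Proof. by apply: mat2_eq; rewrite /= rmorphD !rmorphM. Qed.

Lemma map_mats x ws z : map_mat2 (mats x ws z) = mats (f x) ws (map_par z).
Proof.
elim: ws z => [|s ws IH] z /=.
  by apply: mat2_eq; rewrite /= ?rmorph0 ?rmorph1.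
by rewrite map_mul2 IH map_mat map_pshift.
Qed.

End ContiguityMorphism.

(** ** Transfer of the vanishing of the upper right entry *)

Section ContiguityDomain.
Variable A : idomainType.
Implicit Types (x : A) (z : par A).

Lemma dual_m12 x ws z : no_Sg ws -> 1 - x != 0 -> dual_scalars x ws z != 0 ->
  m12 (mats x ws z) = 0 -> m12 (mats x (rev ws) (dual_par (pshifts ws z))) = 0.
Proof.
move=> hws x1 c0 h; have E := dual_steps x z hws.
have := congr1 (@m11 _) E; have := congr1 (@m12 _) E => /=.
rewrite h !mul0r !mulr0 !addr0 !mul0r !addr0 => /eqP.
rewrite mulf_eq0 => /orP[/eqP->|/eqP//]; rewrite mul0r => /esym/eqP.
by rewrite mulf_eq0 (negPf c0) (negPf x1).
Qed.

Lemma recip_m12 x ws z : no_Sg ws -> 1 - x != 0 -> recip_scalars2 ws z != 0 ->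
  m12 (mats x ws z) = 0 -> m12 (mats (1 - x) (recip_word ws) (recip_par z)) = 0.
Proof.
move=> hws x1 c0 h; have := congr1 (@m12 _) (recip_steps x z hws) => /=.
rewrite h !mul0r !mulr0 !addr0 !mulr0 => /esym/eqP.
by rewrite !mulf_eq0 (negPf c0) (negPf x1) => /eqP.
Qed.

End ContiguityDomain.

(** * Sums of series *)

Section HasSum.
Variable K : numFieldType.
Implicit Types (u v : nat -> K) (s : K).

(** The series of general term [u] converges to [s]. *)
Definition has_sum u s := (series u @ \oo --> s)%classic.

Lemma has_sum_lim u s : has_sum u s -> limn (series u) = s.
Proof. by move=> h; apply/cvg_lim. Qed.

Lemma has_sum_uniq u s s' : has_sum u s -> has_sum u s' -> s = s'.
Proof. by move=> /has_sum_lim <- /has_sum_lim <-. Qed.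

Lemma has_sumD u v s s' : has_sum u s -> has_sum v s' ->
  has_sum (fun n => u n + v n) (s + s').
Proof.
move=> hu hv; rewrite /has_sum.
have -> : series (fun n => u n + v n) = series u \+ series v.
  by apply/funext => n; rewrite /series /= big_split.
exact: cvgD.
Qed.

Lemma has_sumZ k u s : has_sum u s -> has_sum (fun n => k * u n) (k * s).
Proof.
move=> hu; rewrite /has_sum.
have -> : series (fun n => k * u n) = (fun n => k * series u n).
  by apply/funext => n; rewrite /series /= big_distrr.
by apply: cvgM => //; exact: cvg_cst.
Qed.

Lemma has_sum_ext u v s : u =1 v -> has_sum u s -> has_sum v s.
Proof. by move=> /funext ->. Qed.

Lemma has_sumS u s : has_sum (fun n => u n.+1) s -> has_sum u (u 0%N + s).
Proof.
move=> hu; rewrite /has_sum -cvg_shiftS /=.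
have -> : (fun n => series u n.+1) = (fun n => u 0%N + series (fun n => u n.+1) n).
  by apply/funext => n; rewrite /series /= big_nat_recl.
by apply: cvgD => //; exact: cvg_cst.
Qed.

End HasSum.

Arguments has_sumZ {K} k {u s}.

(** * Series of complex numbers *)

Section ComplexSeries.
Variable R : realType.
Local Notation C := (Cplx R).
Implicit Types (u v : nat -> C) (s : C).

HB.instance Definition _ := GRing.RMorphism.copy (@ofR R) (real_complex R).

Lemma ofR_inj : injective (@ofR R).
Proof. exact: complexI. Qed.

Lemma norm_normc (z : C) : `|z| = ofR (normc z).
Proof. by []. Qed.

Lemma normc_ge0 (z : C) : 0 <= normc z.
Proof. by case: z => a b /=; exact: sqrtr_ge0. Qed.

Lemma normc_ofR (x : R) : normc (ofR x) = `|x|.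
Proof. by rewrite /= expr0n /= addr0 sqrtr_sqr. Qed.

Lemma normc_nat n : normc (n%:R : C) = n%:R.
Proof. by rewrite -(rmorph_nat (@ofR R)) normc_ofR normr_nat. Qed.

Lemma normc_Re (z : C) : `|complex.Re z| <= normc z.
Proof. by have := normc_ge_Re z; rewrite lecR. Qed.

Lemma normc_Im (z : C) : `|complex.Im z| <= normc z.
Proof.
case: z => a b /=; rewrite -{1}(@sqrtr_sqr R b) ler_sqrt.
  by rewrite lerDr sqr_ge0.
by rewrite addr_ge0 ?sqr_ge0.
Qed.

Lemma gt0_ofR (e : C) : 0 < e -> exists2 e' : R, 0 < e' & e = ofR e'.
Proof.
case: e => a b; rewrite ltcE /= => /andP[/eqP -> a0]; exists a => //.
Qed.

Lemma cvg_ofR (u : nat -> R) (l : R) :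
  (u @ \oo --> l)%classic -> ((fun n => ofR (u n)) @ \oo --> ofR l)%classic.
Proof.
move=> ul; apply/cvgrPdist_lt => e /gt0_ofR[e' e0 ->].
move/cvgrPdist_lt : ul => /(_ _ e0); apply: filterS => n.
by rewrite -rmorphB norm_normc normc_ofR ltcR.
Qed.

Lemma cvg_Re u s :
  (u @ \oo --> s)%classic -> ((fun n => complex.Re (u n)) @ \oo --> complex.Re s)%classic.
Proof.
move=> ul; apply/cvgrPdist_lt => e e0.
have e0' : (0 : C) < ofR e by rewrite (ltcR 0).
move/cvgrPdist_lt : ul => /(_ _ e0'); apply: filterS => n.
rewrite norm_normc ltcR; apply: le_lt_trans.
have -> : complex.Re s - complex.Re (u n) = complex.Re (s - u n).
  by case: s => ? ?; case: (u n).
exact: normc_Re.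
Qed.

(** A series of complex numbers dominated by a geometric series converges: its
    real and imaginary parts do. *)
Lemma has_sum_geom u (c rho : R) : 0 <= rho -> rho < 1 ->
  (forall n, normc (u n) <= c * rho ^+ n) -> has_sum u (limn (series u)).
Proof.
move=> r0 r1 hu.
have key (v : nat -> R) : (forall n, `|v n| <= c * rho ^+ n) -> cvgn (series v).
  move=> hv; apply: normed_cvg; apply: (series_le_cvg _ _ hv).
  - by move=> n; exact: normr_ge0.
  - by move=> n; apply: le_trans (hv n).
  by apply: is_cvg_geometric_series; rewrite ger0_norm.
have h1 := key _ (fun n => le_trans (normc_Re _) (hu n)).
have h2 := key _ (fun n => le_trans (normc_Im _) (hu n)).
apply/cvg_ex; exists (ofR (limn (series (fun n => complex.Re (u n)))) +
   'i%C * ofR (limn (series (fun n => complex.Im (u n))))).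
have -> : series u = (fun n => ofR (series (fun n => complex.Re (u n)) n) +
   'i%C * ofR (series (fun n => complex.Im (u n)) n)).
  apply/funext => n; rewrite /series /= !rmorph_sum /= big_distrr /= -big_split /=.
  by apply: eq_bigr => i _; exact: complexE.
by apply: cvgD; [exact: cvg_ofR|apply: cvgMr; exact: cvg_ofR].
Qed.

End ComplexSeries.

(** * Contiguity relations of the Gauss series *)

Section GaussSeries.
Variable K : numFieldType.
Implicit Types (x : K) (z : par K).

(** The rising factorial [a (a + 1) ... (a + n - 1)], over any field. *)
Definition rising (a : K) (n : nat) : K := \prod_(0 <= k < n) (a + k%:R).

(** [c] is not a nonpositive integer. *)
Definition regular (c : K) : Prop := forall k : nat, c + k%:R != 0.

(** The [k]-th term of the Gauss series with parameters [z]. *)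
Definition gauss_term x z (k : nat) : K :=
  rising (pa z) k * rising (pb z) k / (rising (pc z) k * (k`!)%:R) * x ^+ k.

Lemma risingS a n : rising a n.+1 = rising a n * (a + n%:R).
Proof. by rewrite /rising big_nat_recr. Qed.

Lemma rising_recl a n : rising a n.+1 = a * rising (a + 1) n.
Proof.
rewrite /rising big_nat_recl //= addr0; congr (_ * _).
by apply: eq_bigr => i _; rewrite -nat1r addrA.
Qed.

Lemma rising1 a n : a * rising (a + 1) n = (a + n%:R) * rising a n.
Proof. by rewrite -rising_recl risingS mulrC. Qed.

Lemma rising_neq0 c n : regular c -> rising c n != 0.
Proof. by move=> hc; elim: n => [|n IH]; rewrite ?risingS ?mulf_neq0 // /rising big_nil oner_neq0. Qed.

Lemma regular1 c : regular c -> regular (c + 1).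
Proof. by move=> h k; rewrite -addrA nat1r. Qed.

Lemma regular_neq0 c : regular c -> c != 0.
Proof. by move/(_ 0%N); rewrite addr0. Qed.

Lemma gauss_term0 x z : gauss_term x z 0 = 1.
Proof. by rewrite /gauss_term /rising !big_nil fact0 !mulr1 divr1. Qed.

Lemma gauss_termS x z k : regular (pc z) ->
  (k%:R + 1) * (pc z + k%:R) * gauss_term x z k.+1 =
  (pa z + k%:R) * (pb z + k%:R) * x * gauss_term x z k.
Proof.
move=> hc; rewrite /gauss_term !risingS factS natrM exprS -nat1r.
have h1 := hc k; have h2 := rising_neq0 k hc.
have h3 : (k`!)%:R != 0 :> K by rewrite pnatr_eq0 -lt0n fact_gt0.
have h4 : 1 + k%:R != 0 :> K by rewrite nat1r pnatr_eq0.
by field; rewrite h1 h2 h3 h4.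
Qed.

(** Raising the three parameters amounts to differentiating the series. *)
Definition shift3 z := Par (pa z + 1) (pb z + 1) (pc z + 1).

Lemma gauss_term_deriv x z k : regular (pc z) ->
  k.+1%:R * gauss_term x z k.+1 =
  (pa z * pb z / pc z * x) * gauss_term x (shift3 z) k.
Proof.
move=> hc; rewrite /gauss_term !rising_recl /= factS natrM exprS -nat1r.
have h1 := regular_neq0 hc; have h2 := rising_neq0 k (regular1 hc).
have h3 : (k`!)%:R != 0 :> K by rewrite pnatr_eq0 -lt0n fact_gt0.
have h4 : 1 + k%:R != 0 :> K by rewrite nat1r pnatr_eq0.
by field; rewrite h1 h2 h3 h4.
Qed.

(** The values at [x] of the series [F], of [theta F] and of [theta^2 F]. *)
Definition gauss x z : K := limn (series (gauss_term x z)).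
Definition gauss1 x z : K :=
  limn (series (fun k => k%:R * gauss_term x z k)).
Definition gauss2 x z : K :=
  limn (series (fun k => k%:R ^+ 2 * gauss_term x z k)).

Variable x : K.
Hypothesis x1 : 1 - x != 0.
Hypothesis summable : forall z, regular (pc z) -> cvgn (series (gauss_term x z)).

Lemma has_sum_gauss z : regular (pc z) ->
  has_sum (gauss_term x z) (gauss x z).
Proof. exact: summable. Qed.

Lemma has_sum_gauss1 z : regular (pc z) ->
  has_sum (fun k => k%:R * gauss_term x z k) (gauss1 x z).
Proof.
move=> hc; suff [s hs] : exists s, has_sum (fun k => k%:R * gauss_term x z k) s.
  by rewrite /gauss1 (has_sum_lim hs).
eexists; apply: has_sumS.
apply: (has_sum_ext (u := fun k => (pa z * pb z / pc z * x) * gauss_term x (shift3 z) k)).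
  by move=> k; rewrite gauss_term_deriv.
by apply: has_sumZ; apply: has_sum_gauss; exact: regular1.
Qed.

Lemma has_sum_gauss2 z : regular (pc z) ->
  has_sum (fun k => k%:R ^+ 2 * gauss_term x z k) (gauss2 x z).
Proof.
move=> hc; suff [s hs] : exists s, has_sum (fun k => k%:R ^+ 2 * gauss_term x z k) s.
  by rewrite /gauss2 (has_sum_lim hs).
have hc1 : regular (pc (shift3 z)) by exact: regular1.
eexists; apply: has_sumS.
apply: (has_sum_ext (u := fun k => (pa z * pb z / pc z * x) *
   (k%:R * gauss_term x (shift3 z) k + gauss_term x (shift3 z) k))).
  move=> k; rewrite [X in _ = X * _]expr2 -[RHS]mulrA gauss_term_deriv //.
  by rewrite -nat1r; ring.
by apply: has_sumZ; apply: has_sumD; [exact: has_sum_gauss1|exact: has_sum_gauss].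
Qed.

(** The hypergeometric equation, from the recurrence between consecutive
    terms. *)
Lemma gauss_ode z : regular (pc z) ->
  (1 - x) * gauss2 x z =
  ((pa z + pb z) * x - (pc z - 1)) * gauss1 x z + pa z * pb z * x * gauss x z.
Proof.
move=> hc; have h0 := has_sum_gauss hc; have h1 := has_sum_gauss1 hc.
have h2 := has_sum_gauss2 hc.
have A := has_sumD h2 (has_sumZ (pc z - 1) h1).
have B := has_sumZ x (has_sumD h2 (has_sumD (has_sumZ (pa z + pb z) h1)
   (has_sumZ (pa z * pb z) h0))).
have E : gauss2 x z + (pc z - 1) * gauss1 x z = x *
   (gauss2 x z + ((pa z + pb z) * gauss1 x z + pa z * pb z * gauss x z)).
  apply: (has_sum_uniq A); rewrite -[X in has_sum _ X]add0r.
  have -> : 0 = (0 : nat)%:R ^+ 2 * gauss_term x z 0 +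
     (pc z - 1) * ((0 : nat)%:R * gauss_term x z 0) by rewrite expr2; ring.
  apply: has_sumS; apply: has_sum_ext B => k /=.
  have := gauss_termS x k hc; rewrite -!nat1r => E.
  have -> : (1 + k%:R) ^+ 2 * gauss_term x z k.+1 +
    (pc z - 1) * ((1 + k%:R) * gauss_term x z k.+1) =
    (k%:R + 1) * (pc z + k%:R) * gauss_term x z k.+1 by ring.
  by rewrite E; ring.
transitivity (gauss2 x z + (pc z - 1) * gauss1 x z - x * gauss2 x z
  - (pc z - 1) * gauss1 x z); first by ring.
by rewrite E; ring.
Qed.

(** The action of [theta + y], when it maps the series with parameters [z] to [y]
    times the series with parameters [z']. *)
Lemma theta_act z z' y : regular (pc z) -> regular (pc z') ->
  (forall k, y * gauss_term x z' k = (y + k%:R) * gauss_term x z k) ->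
  (1 - x) * y * gauss x z' = m11 (theta_mx x y z) * gauss x z +
    m12 (theta_mx x y z) * gauss1 x z /\
  (1 - x) * y * gauss1 x z' = m21 (theta_mx x y z) * gauss x z +
    m22 (theta_mx x y z) * gauss1 x z.
Proof.
move=> hc hc' h.
have h0 := has_sum_gauss hc; have h1 := has_sum_gauss1 hc.
have h2 := has_sum_gauss2 hc.
have E0 : y * gauss x z' = y * gauss x z + gauss1 x z.
  apply: (has_sum_uniq (has_sumZ y (has_sum_gauss hc'))).
  apply: has_sum_ext (has_sumD (has_sumZ y h0) h1) => k /=.
  by rewrite h; ring.
have E1 : y * gauss1 x z' = y * gauss1 x z + gauss2 x z.
  apply: (has_sum_uniq (has_sumZ y (has_sum_gauss1 hc'))).
  apply: has_sum_ext (has_sumD (has_sumZ y h1) h2) => k /=.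
  by rewrite [RHS]mulrCA h; ring.
have := gauss_ode hc; rewrite /= -!mulrA E0 E1 => E.
by split; [ring|rewrite mulrDr E; ring].
Qed.

(** The vectors [(f, g)] and [(f', g')] satisfy [D (f', g') = M (f, g)]. *)
Definition contiguous (D : K) (M : mat2 K) (f g f' g' : K) :=
  D * f' = m11 M * f + m12 M * g /\ D * g' = m21 M * f + m22 M * g.

Lemma contiguous_inv D M f g f' g' : contiguous D M f g f' g' ->
  contiguous (det2 M) (scale2 D (adj2 M)) f' g' f g.
Proof.
rewrite /contiguous /det2 /= => -[e1 e2].
split.
  by transitivity (m22 M * (D * f') - m12 M * (D * g')); [rewrite e1 e2|]; ring.
by transitivity (m11 M * (D * g') - m21 M * (D * f')); [rewrite e1 e2|]; ring.
Qed.

Lemma contiguous_cancel k D M f g f' g' : k != 0 ->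
  contiguous (k * D) (scale2 k M) f g f' g' -> contiguous D M f g f' g'.
Proof.
by move=> k0 [] /=; rewrite -!mulrA -!mulrDr => /(mulfI k0) ? /(mulfI k0).
Qed.

Lemma contiguity_step s z : regular (pc z) -> regular (pc (pshift s z)) ->
  contiguous (den x s z) (mat x s z) (gauss x z) (gauss1 x z)
    (gauss x (pshift s z)) (gauss1 x (pshift s z)).
Proof.
move=> hc; case: s => /= hc'.
- apply: theta_act => // k; rewrite /gauss_term /=.
  rewrite !mulrA [pa z * _]rising1; ring.
- have hb k : (pb z - 1) * gauss_term x z k =
      (pb z - 1 + k%:R) * gauss_term x (pshift Sb z) k.
    rewrite /gauss_term /= -{2}[pb z](subrK 1).
    transitivity (rising (pa z) k * ((pb z - 1) * rising (pb z - 1 + 1) k) /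
       (rising (pc z) k * k`!%:R) * x ^+ k); first by ring.
    by rewrite rising1; ring.
  apply: (@contiguous_cancel (1 - x)) => //.
  have /contiguous_inv := theta_act (z := pshift Sb z) hc' hc hb.
  rewrite -/(theta_mx _ _ _); congr contiguous.
    by rewrite /det2 /=; ring.
  by apply: mat2_eq => /=; ring.
- have hb k : pc z * gauss_term x z k =
      (pc z + k%:R) * gauss_term x (pshift Sc z) k.
    rewrite /gauss_term /=.
    have h1 := rising_neq0 k hc; have h2 := rising_neq0 k hc'.
    have h3 : (k`!)%:R != 0 :> K by rewrite pnatr_eq0 -lt0n fact_gt0.
    have h4 := hc k; have h5 := regular_neq0 hc.
    have e : rising (pc z + 1) k = (pc z + k%:R) * rising (pc z) k / pc z.
      by rewrite -rising1; field.
    by rewrite e; field; rewrite h1 h3 h4 h5.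
  apply: (@contiguous_cancel (1 - x)) => //.
  have /contiguous_inv := theta_act (z := pshift Sc z) hc' hc hb.
  congr contiguous.
    by rewrite /det2 /=; ring.
  by apply: mat2_eq => /=; ring.
- apply: theta_act => // k; rewrite /gauss_term /=.
  have h1 := rising_neq0 k hc; have h2 := rising_neq0 k hc'.
  have h3 : (k`!)%:R != 0 :> K by rewrite pnatr_eq0 -lt0n fact_gt0.
  have h4 := hc' k; have h5 := regular_neq0 hc'.
  have e : rising (pc z) k = (pc z - 1 + k%:R) * rising (pc z - 1) k / (pc z - 1).
    by rewrite -rising1 subrK; field.
  by rewrite e; field; rewrite h2 h3 h4 h5.
Qed.

(** Every parameter met along the chain is regular. *)
Fixpoint regulars (ws : seq step) z : Prop :=
  if ws is s :: ws' then regular (pc z) /\ regulars ws' (pshift s z)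
  else regular (pc z).

Lemma contiguity ws z : regulars ws z ->
  contiguous (dens x ws z) (mats x ws z) (gauss x z) (gauss1 x z)
    (gauss x (pshifts ws z)) (gauss1 x (pshifts ws z)).
Proof.
elim: ws z => [|s ws IH] z /=; first by rewrite /contiguous /= !mul1r !mul0r addr0 add0r.
move=> [hc hs]; have hc' : regular (pc (pshift s z)) by case: (ws) hs => //= ? ? [].
have [e1 e2] := contiguity_step hc hc'; have [e3 e4] := IH _ hs.
set D := dens _ _ _ in e3 e4 *; set M := mats _ _ _ in e3 e4 *.
split => /=.
  transitivity (den x s z * (D * gauss x (pshifts ws (pshift s z)))); first by ring.
  transitivity (m11 M * (den x s z * gauss x (pshift s z)) +
    m12 M * (den x s z * gauss1 x (pshift s z))); first by rewrite e3; ring.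
  by rewrite e1 e2; ring.
transitivity (den x s z * (D * gauss1 x (pshifts ws (pshift s z)))); first by ring.
transitivity (m21 M * (den x s z * gauss x (pshift s z)) +
  m22 M * (den x s z * gauss1 x (pshift s z))); first by rewrite e4; ring.
by rewrite e1 e2; ring.
Qed.

End GaussSeries.

(** * Convergence of the Gauss series *)

Section Convergence.
Variable R : realType.
Local Notation C := (Cplx R).

(** The ratio test, as a geometric bound. *)
Lemma ratio_geom (v : nat -> R) (rho : R) (N : nat) : 0 < rho ->
  (forall k, 0 <= v k) -> (forall k, (N <= k)%N -> v k.+1 <= rho * v k) ->
  exists c, forall k, v k <= c * rho ^+ k.
Proof.
move=> r0 v0 hv; exists (\sum_(j < N.+1) v j / rho ^+ j) => k.
have small j : (j <= N)%N ->
    v j <= (\sum_(j < N.+1) v j / rho ^+ j) * rho ^+ j.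
  move=> jN; rewrite -ler_pdivrMr ?exprn_gt0 //.
  rewrite (bigD1 (Ordinal (jN : (j < N.+1)%N))) //= lerDl.
  by apply: sumr_ge0 => i _; rewrite divr_ge0 // exprn_ge0 // ltW.
elim: k => [|k IH]; first exact: small.
case: (leqP k.+1 N) => [|kN]; first exact: small.
apply: (le_trans (hv _ _)); first by [].
by rewrite exprS mulrCA ler_pM2l.
Qed.

Lemma normcD (y z : C) : normc (y + z) <= normc y + normc z.
Proof. by have := ler_normD y z; rewrite !norm_normc -rmorphD lecR. Qed.

Lemma summable_gauss (x : R) (z : par C) : 0 < x < 1 -> regular (pc z) ->
  cvgn (series (gauss_term (ofR x) z)).
Proof.
move=> /andP[x0 x1] hc.
pose v k := normc (gauss_term (ofR x) z k).
pose A := normc (pa z); pose B := normc (pb z); pose G := normc (pc z).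
have A0 : 0 <= A by exact: normc_ge0.
have B0 : 0 <= B by exact: normc_ge0.
have G0 : 0 <= G by exact: normc_ge0.
(* The ratio of consecutive terms tends to [x < rho < 1]; it is at most [rho] as
   soon as [k > E + G + 1], with [E] as below. *)
pose rho := (1 + x) / 2.
have rx : 0 < rho - x by rewrite /rho; lra.
have r1 : rho < 1 by rewrite /rho; lra.
have r0 : 0 < rho by rewrite /rho; lra.
pose E := (A + B + A * B + 2 * G) / (rho - x).
have E0 : 0 <= E by apply: divr_ge0; [rewrite !addr_ge0 ?mulr_ge0|exact: ltW].
have [c hcv] : exists c, forall k, v k <= c * rho ^+ k.
  apply: (@ratio_geom v rho (Num.bound (E + G + 1))) => // k; first exact: normc_ge0.
  move=> hk; have hk' : E + G + 1 < k%:R.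
    apply: (lt_le_trans (archi_boundP _)); first by lra.
    by rewrite ler_nat.
  have kE : A + B + A * B + 2 * G <= k%:R * (rho - x).
    rewrite -ler_pdivrMr // -/E; lra.
  have := congr1 (@normc R) (gauss_termS (ofR x) k hc); rewrite {}/v.
  move: (gauss_term _ z k) (gauss_term _ z k.+1) => t0 t1.
  rewrite !normcM normc_ofR gtr0_norm //.
  have -> : (k%:R + 1 : C) = k.+1%:R by exact: natr1.
  rewrite normc_nat -natr1 => e.
  have v0 : 0 <= normc t0 by exact: normc_ge0.
  have v1 : 0 <= normc t1 by exact: normc_ge0.
  have ha : normc (pa z + k%:R) <= A + k%:R by rewrite -(normc_nat R k) normcD.
  have hb : normc (pb z + k%:R) <= B + k%:R by rewrite -(normc_nat R k) normcD.
  have hg : k%:R - G <= normc (pc z + k%:R).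
    have -> : k%:R = normc ((pc z + k%:R) + - pc z).
      by rewrite addrAC subrr add0r normc_nat.
    by rewrite lerBlDr (le_trans (normcD _ _)) // (normcN (pc z)).
  have k1 : 1 <= k%:R :> R by lra.
  have kG : 0 < k%:R - G by lra.
  have ha0 : 0 <= normc (pa z + k%:R) by exact: normc_ge0.
  have hb0 : 0 <= normc (pb z + k%:R) by exact: normc_ge0.
  set K := (k%:R : R) in e ha hb hg k1 kG kE *.
  have step1 : (K + 1) * (K - G) * normc t1 <= (A + K) * (B + K) * x * normc t0.
    apply: (@le_trans _ _ ((K + 1) * normc (pc z + k%:R) * normc t1)).
      by rewrite ler_wpM2r // ler_wpM2l //; lra.
    by rewrite e ler_wpM2r // (ler_wpM2r (ltW x0)) // ler_pM.
  have step2 : (A + K) * (B + K) * x <= rho * ((K + 1) * (K - G)).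
    have K0 : 0 <= K by lra.
    have AB0 : 0 <= A * B by exact: mulr_ge0.
    have h1 : (A + B) * K * x <= (A + B) * K.
      by rewrite ler_piMr ?mulr_ge0 ?addr_ge0 //; lra.
    have h2 : A * B * x <= A * B * K by rewrite ler_wpM2l //; lra.
    have h3 : rho * (G * K) <= G * K by rewrite ler_piMl ?mulr_ge0 //; lra.
    have h4 : rho * G <= G * K.
      by rewrite mulrC ler_wpM2l //; lra.
    have h5 : 0 <= rho * K by rewrite mulr_ge0 //; lra.
    have h6 := ler_wpM2l K0 kE.
    have h7 : A * B <= A * B * K by rewrite ler_peMr.
    lra.
  have kp : 0 < (K + 1) * (K - G) by rewrite mulr_gt0 //; lra.
  rewrite -(ler_pM2l kp) (le_trans step1) // mulrA [_ * rho]mulrC.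
  by rewrite ler_wpM2r.
exact: (@has_sum_geom R (gauss_term (ofR x) z) c rho (ltW r0) r1 hcv).
Qed.

End Convergence.

(** * Real parameters *)

Section RealParameters.
Variable R : realType.
Local Notation C := (Cplx R).

Lemma regular_ofR (c : R) : regular c -> regular (ofR c : C).
Proof.
by move=> h k; rewrite -(rmorph_nat (@ofR R)) -rmorphD fmorph_eq0.
Qed.

(** For real parameters, the complex series is the image of the real one. *)
Lemma gauss_term_ofR (x : R) (z : par R) k :
  gauss_term (ofR x : C) (map_par (@ofR R) z) k = ofR (gauss_term x z k).
Proof.
have h (a : R) : rising (ofR a : C) k = ofR (rising a k).
  by rewrite /rising rmorph_prod; apply: eq_bigr => i _; rewrite rmorphD rmorph_nat.
by rewrite /gauss_term !h !rmorphM fmorphV rmorphM rmorph_nat rmorphXn.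
Qed.

Lemma summable_gaussR (x : R) : 0 < x < 1 ->
  forall z : par R, regular (pc z) -> cvgn (series (gauss_term x z)).
Proof.
move=> hx z hc.
have := summable_gauss (z := map_par (@ofR R) z) hx (regular_ofR hc).
move=> /cvg_ex[l /cvg_Re hl]; apply/cvg_ex; exists (complex.Re l).
suff -> : series (gauss_term x z) = (fun n => complex.Re
  (series (gauss_term (ofR x : C) (map_par (@ofR R) z)) n)) by [].
apply/funext => n; rewrite /series /=.
under [in RHS]eq_bigr do rewrite gauss_term_ofR.
by rewrite -rmorph_sum.
Qed.

Lemma gauss_ofR (x : R) (z : par R) : 0 < x < 1 -> regular (pc z) ->
  gauss (ofR x : C) (map_par (@ofR R) z) = ofR (gauss x z).
Proof.
move=> hx hc; apply: has_sum_lim.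
rewrite /has_sum.
have -> : series (gauss_term (ofR x : C) (map_par (@ofR R) z)) =
    (fun n => ofR (series (gauss_term x z) n)).
  apply/funext => n; rewrite /series /= rmorph_sum.
  by apply: eq_bigr => i _; rewrite gauss_term_ofR.
exact: cvg_ofR (summable_gaussR hx hc).
Qed.

(** The parameters of [hypf l] at a real [w]. *)
Definition line_par (l : data R) (w : R) : par R :=
  Par (dp l * w + da l) (dq l * w + db l) (dr l * w).

Lemma hypfE (l : data R) (w : C) :
  hypf l w = gauss (ofR (dx l) : C) (Par (ofR (dp l) * w + ofR (da l))
    (ofR (dq l) * w + ofR (db l)) (ofR (dr l) * w)).
Proof. by []. Qed.

Lemma hypf_ofR (l : data R) (w : R) : 0 < dx l < 1 -> regular (dr l * w) ->
  hypf l (ofR w) = ofR (gauss (dx l) (line_par l w)).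
Proof.
move=> hx hc; rewrite hypfE -(gauss_ofR (z := line_par l w) hx hc).
have -> // : Par (ofR (dp l) * ofR w + ofR (da l)) (ofR (dq l) * ofR w + ofR (db l))
  (ofR (dr l) * ofR w) = map_par (@ofR R) (line_par l w) :> par C.
by rewrite /map_par /line_par /=; congr (Par _ _ _);
  rewrite ?rmorphD ?rmorphM.
Qed.

End RealParameters.

(** * Estimates for real parameters *)

Section Estimates.
Variables (R : realType) (x : R).
Hypothesis hx : 0 < x < 1.
Implicit Types (z : par R) (a b c : R).

Let x0 : 0 < x. Proof. by case/andP: hx. Qed.
Let x1 : x < 1. Proof. by case/andP: hx. Qed.
Let x1' : 1 - x != 0. Proof. by rewrite subr_eq0 gt_eqF. Qed.
Let S := summable_gaussR hx.

Lemma regular_gt0 c : 0 < c -> regular c.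
Proof. by move=> c0 k; rewrite gt_eqF // ltr_wpDr // ler0n. Qed.

Lemma rising_ge0 a k : 0 <= a -> 0 <= rising a k.
Proof. by move=> a0; apply: prodr_ge0 => i _; rewrite addr_ge0 // ler0n. Qed.

Lemma rising_gt0 a k : 0 < a -> 0 < rising a k.
Proof. by move=> a0; apply: prodr_gt0 => i _; rewrite ltr_wpDr // ler0n. Qed.

Lemma gauss_term_ge0 z k : 0 <= pa z -> 0 <= pb z -> 0 < pc z ->
  0 <= gauss_term x z k.
Proof.
move=> a0 b0 c0; rewrite /gauss_term mulr_ge0 ?exprn_ge0 ?(ltW x0) //.
by rewrite divr_ge0 ?mulr_ge0 ?rising_ge0 // ?ler0n // ltW.
Qed.

Lemma partial_le_sum (u : nat -> R) s N : (forall k, 0 <= u k) ->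
  has_sum u s -> series u N <= s.
Proof.
move=> u0 hu; rewrite -(has_sum_lim hu).
apply: nondecreasing_cvgn_le; last by apply/cvg_ex; exists s.
apply/nondecreasing_seqP => n.
by rewrite /series /= big_nat_recr //= lerDl.
Qed.

Lemma gauss_ge1 z : 0 <= pa z -> 0 <= pb z -> 0 < pc z -> 1 <= gauss x z.
Proof.
move=> a0 b0 c0.
have h k : 0 <= gauss_term x z k by exact: gauss_term_ge0.
have := partial_le_sum 1 h (has_sum_gauss S (regular_gt0 c0)).
by rewrite /series /= big_nat1 gauss_term0.
Qed.

(** With nonnegative terms, [F] is at least its term of degree 1. *)
Lemma gauss_ge_linear z : 0 <= pa z -> 0 <= pb z -> 0 < pc z ->
  pa z * pb z / pc z * x <= gauss x z.
Proof.
move=> a0 b0 c0.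
have h k : 0 <= gauss_term x z k by exact: gauss_term_ge0.
have := partial_le_sum 2 h (has_sum_gauss S (regular_gt0 c0)).
rewrite /series /= big_nat_recr //= big_nat1; apply: le_trans.
rewrite gauss_term0 /gauss_term /rising !big_nat1 !addr0 expr1 mulr1.
by rewrite lerDr.
Qed.

Lemma gauss1_ge0 z : 0 <= pa z -> 0 <= pb z -> 0 < pc z -> 0 <= gauss1 x z.
Proof.
move=> a0 b0 c0.
have h k : 0 <= k%:R * gauss_term x z k.
  by rewrite mulr_ge0 ?ler0n ?gauss_term_ge0.
have := partial_le_sum 0 h (has_sum_gauss1 S (regular_gt0 c0)).
by rewrite /series /= big_geq.
Qed.

(** If [-1 <= b <= 0], all the terms of [theta F] are nonpositive. *)
Lemma gauss1_le0 z : 0 <= pa z -> -1 <= pb z <= 0 -> 0 < pc z ->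
  gauss1 x z <= 0.
Proof.
move=> a0 /andP[b0 b1] c0.
have h k : 0 <= -1 * (k%:R * gauss_term x z k).
  case: k => [|k]; first by rewrite mul0r mulr0.
  rewrite mulN1r -mulrN mulr_ge0 ?ler0n // /gauss_term [rising (pb z) _]rising_recl.
  have -> : - (rising (pa z) k.+1 * (pb z * rising (pb z + 1) k) /
     (rising (pc z) k.+1 * (k.+1)`!%:R) * x ^+ k.+1) =
     rising (pa z) k.+1 * (- pb z * rising (pb z + 1) k) /
     (rising (pc z) k.+1 * (k.+1)`!%:R) * x ^+ k.+1 by ring.
  rewrite mulr_ge0 ?exprn_ge0 ?(ltW x0) // divr_ge0 //.
    by rewrite mulr_ge0 ?rising_ge0 // mulr_ge0 ?oppr_ge0 // rising_ge0 //; lra.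
  by rewrite mulr_ge0 ?ler0n // ltW // rising_gt0.
have := partial_le_sum 0 h (has_sumZ (-1) (has_sum_gauss1 S (regular_gt0 c0))).
by rewrite /series /= big_geq // mulN1r oppr_ge0.
Qed.

(** The relation of [Sb] without the factor [b - 1]. *)
Lemma lower_b a b c : 0 < c -> b != 1 ->
  (c - b) * gauss x (Par a (b - 1) c) =
    (c - b - a * x) * gauss x (Par a b c) + (1 - x) * gauss1 x (Par a b c) /\
  (c - b) * gauss1 x (Par a (b - 1) c) =
    (b - 1) * (a * x * gauss x (Par a b c) - (1 - x) * gauss1 x (Par a b c)).
Proof.
move=> c0 b1; have hc := regular_gt0 c0.
have [] := contiguity_step x1' S (s := Sb) (z := Par a b c) hc hc.
have b1' : b - 1 != 0 by rewrite subr_eq0.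
move=> /= e1 e2; split; apply: (mulfI b1').
  transitivity (- ((b - 1) * (b - c) * gauss x (Par a (b - 1) c))); first by ring.
  by rewrite e1; ring.
transitivity (- ((b - 1) * (b - c) * gauss1 x (Par a (b - 1) c))); first by ring.
by rewrite e2; ring.
Qed.

(** For [b <= 0] the logarithmic derivative [theta F / F] lies between
    [b x / (1 - x)] and [0]; this cone is stable under [b -> b - 1]. *)
Lemma gauss_cone a b c n : 0 < a -> a + 1 <= c -> -1 < b <= 0 ->
  [/\ 0 < gauss x (Par a (b - n%:R) c), gauss1 x (Par a (b - n%:R) c) <= 0 &
      (b - n%:R) * x * gauss x (Par a (b - n%:R) c) <=
      (1 - x) * gauss1 x (Par a (b - n%:R) c)].
Proof.
move=> a0 ac /andP[b1 b0]; have c0 : 0 < c by lra.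
have [y0 y1] : 0 < x /\ x < 1 by [].
have ax : a * x < a by rewrite gtr_pMr.
have ax0 : 0 < a * x by rewrite mulr_gt0.
elim: n => [|n]; last first.
  rewrite -natr1 opprD addrA; set b' := b - n%:R => -[F0 G0 L].
  have b'0 : b' <= 0 by rewrite /b'; have := ler0n R n; lra.
  have b'1 : b' != 1 by rewrite lt_eqF //; lra.
  have [e1 e2] := lower_b a c0 b'1.
  move: (gauss x (Par a b' c)) (gauss1 x (Par a b' c)) F0 G0 L e1 e2 => F G.
  move: (gauss x (Par a (b' - 1) c)) (gauss1 x (Par a (b' - 1) c)) => F' G'.
  move=> F0 G0 L e1 e2; have cb : 0 < c - b' by lra.
  have bF : 0 <= - b' * (1 - x) * F.
    by rewrite !mulr_ge0 ?oppr_ge0 ?subr_ge0 //; exact: ltW.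
  have cF : 0 < (c - a * x) * F by rewrite mulr_gt0 //; lra.
  have F'0 : 0 < F' by rewrite -(pmulr_rgt0 _ cb) e1; lra.
  split=> //.
    rewrite -(pmulr_rle0 _ cb) e2 mulr_le0_ge0 //; first by lra.
    by rewrite subr_ge0; apply: (@le_trans _ _ 0);
      [rewrite mulr_ge0_le0 //; lra|rewrite mulr_ge0 // ltW].
  rewrite -(ler_pM2l cb).
  (* both sides are expressed by the values at [b'], where the difference is a sum
   of nonnegative terms *)
  have -> : (c - b') * ((b' - 1) * x * F') = (b' - 1) * x * ((c - b') * F') by ring.
  have -> : (c - b') * ((1 - x) * G') = (1 - x) * ((c - b') * G') by ring.
  rewrite e1 e2 -subr_ge0.
  have -> : (1 - x) * ((b' - 1) * (a * x * F - (1 - x) * G)) -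
    (b' - 1) * x * ((c - b' - a * x) * F + (1 - x) * G) =
    (1 - b') * (((1 - x) * G - b' * x * F) + x * (c - a) * F) by ring.
  rewrite mulr_ge0 //; first by lra.
  by rewrite addr_ge0 ?subr_ge0 // !mulr_ge0 //; [exact: ltW|lra|exact: ltW].
rewrite subr0; have [->|bn0] := eqVneq b 0.
  split; first by apply: lt_le_trans (gauss_ge1 _ _ _) => //=; lra.
    by apply: gauss1_le0 => //=; lra.
  rewrite !mul0r mulr_ge0 //; first by lra.
  by apply: gauss1_ge0 => //=; lra.
(* for [-1 < b < 0], one step down from [b + 1], where all the terms are
   nonnegative *)
have b0' : b < 0 by rewrite lt_neqAle bn0.
have b'1 : b + 1 != 1 by rewrite lt_eqF //; lra.
have := lower_b a c0 b'1; rewrite addrK => -[e1 e2].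
have F1 : 1 <= gauss x (Par a (b + 1) c) by apply: gauss_ge1 => //=; lra.
have G1 : 0 <= gauss1 x (Par a (b + 1) c) by apply: gauss1_ge0 => //=; lra.
have G0 : gauss1 x (Par a b c) <= 0 by apply: gauss1_le0 => //=; lra.
move: (gauss x (Par a (b + 1) c)) (gauss1 x (Par a (b + 1) c)) e1 e2 F1 G1 => F G.
move: (gauss x _) (gauss1 x _) G0 => F' G' G0 e1 e2 F1 G1.
have cb : 0 < c - (b + 1) by lra.
have cF : 0 < (c - (b + 1) - a * x) * F by rewrite mulr_gt0 //; lra.
have xG : 0 <= (1 - x) * G by rewrite mulr_ge0 //; lra.
have F'0 : 0 < F' by rewrite -(pmulr_rgt0 _ cb) e1; lra.
split=> //.
rewrite -(ler_pM2l cb).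
have -> : (c - (b + 1)) * (b * x * F') = b * x * ((c - (b + 1)) * F') by ring.
have -> : (c - (b + 1)) * ((1 - x) * G') = (1 - x) * ((c - (b + 1)) * G') by ring.
rewrite e1 e2 -subr_ge0.
have -> : (1 - x) * (b * (a * x * F - (1 - x) * G)) -
  b * x * ((c - (b + 1) - a * x) * F + (1 - x) * G) =
  - b * ((1 - x) * G + x * (c - (b + 1) - a) * F) by ring.
rewrite mulr_ge0 //; first by lra.
by rewrite addr_ge0 // !mulr_ge0 //; [exact: ltW|lra|lra].
Qed.

Lemma gauss_gt0 a b c : 0 < a -> a + 1 <= c -> b <= 1 -> 0 < gauss x (Par a b c).
Proof.
move=> a0 ac b1; have c0 : 0 < c by lra.
have [b0|b0] := lerP 0 b.
  by apply: lt_le_trans (gauss_ge1 _ _ _) => //; exact: ltW.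
pose n := Num.truncn (- b).
have [h1 h2] : n%:R <= - b /\ - b < n%:R + 1.
  have := truncn_itv (_ : 0 <= - b); rewrite -natr1 -/n => /(_ _)/andP[]//; lra.
have [] := @gauss_cone a (b + n%:R) c n a0 ac; first by lra.
by rewrite addrK.
Qed.

(** Partial sums of the binomial series of exponent [- B]; multiplication by
    [1 - x] telescopes them. *)
Lemma binomial_series_le (B m : nat) :
  \sum_(0 <= k < m) rising B%:R k / (k`!)%:R * x ^+ k <= (1 - x) ^- B.
Proof.
elim: B => [|B IH].
  rewrite expr0 invr1; case: m => [|m]; first by rewrite big_geq.
  rewrite big_nat_recl //= big1 ?addr0 => [|i _].
    by rewrite /rising big_nil fact0 expr0 mulr1 divr1.
  by rewrite rising_recl !mul0r.
pose t (B : nat) k : R := rising B%:R k / (k`!)%:R * x ^+ k.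
have t0 k : 0 <= t B.+1 k.
  by rewrite /t mulr_ge0 ?exprn_ge0 ?(ltW x0) // divr_ge0 ?ler0n // rising_ge0 // ler0n.
have tS k : t B.+1 k.+1 - x * t B.+1 k = t B k.+1.
  rewrite /t [rising B%:R _]rising_recl [rising B.+1%:R k.+1]risingS factS natrM.
  rewrite exprS -!natr1.
  have h3 : (k`!)%:R != 0 :> R by rewrite pnatr_eq0 -lt0n fact_gt0.
  have h4 : k%:R + 1 != 0 :> R by rewrite natr1 pnatr_eq0.
  by field; rewrite h3 h4.
have tel n : (1 - x) * (\sum_(0 <= k < n.+1) t B.+1 k) =
    \sum_(0 <= k < n.+1) t B k - x * t B.+1 n.
  elim: n => [|n IHn].
    by rewrite !big_nat1 /t /rising !big_nil fact0 expr0; ring.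
  rewrite big_nat_recr //= mulrDr IHn [in RHS]big_nat_recr //= -tS; ring.
have x1p : 0 < 1 - x by rewrite subr_gt0.
rewrite -/(\sum_(0 <= k < m) t B.+1 k) exprS invfM ler_pdivlMl //.
case: m IH => [|m] IH.
  by rewrite big_geq // mulr0 ltW // invr_gt0 exprn_gt0.
rewrite tel; apply: le_trans IH; rewrite gerBl mulr_ge0 //; exact: ltW.
Qed.

(** For [0 < a <= c] the Gauss series is dominated by a binomial series. *)
Lemma gauss_le a b c (B : nat) : 0 < a -> a <= c -> `|b| <= B%:R ->
  `|gauss x (Par a b c)| <= (1 - x) ^- B.
Proof.
move=> a0 ac hb; have c0 : 0 < c by lra.
have hs := has_sum_gauss S (regular_gt0 c0 : regular (pc (Par a b c))).
have risle k : `|rising b k| <= rising B%:R k.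
  rewrite /rising normr_prod ler_prod // => i _; rewrite normr_ge0 /=.
  by rewrite (le_trans (ler_normD _ _)) // normr_nat lerD2r.
have hp m : `|series (gauss_term x (Par a b c)) m| <= (1 - x) ^- B.
  rewrite /series /=; apply: le_trans (ler_norm_sum _ _ _) _.
  apply: le_trans (binomial_series_le B m); apply: ler_sum => k _.
  rewrite /gauss_term /= !normrM normfV.
  rewrite [`|x ^+ k|]ger0_norm ?exprn_ge0 ?(ltW x0) //.
  rewrite ler_wpM2r ?exprn_ge0 ?(ltW x0) // normrM normr_nat invfM mulrA.
  rewrite ler_wpM2r ?invr_ge0 ?ler0n // mulrAC.
  rewrite -[leRHS]mul1r ler_pM ?mulr_ge0 ?invr_ge0 //.
  rewrite !gtr0_norm ?rising_gt0 // ler_pdivrMr ?rising_gt0 // mul1r.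
  by rewrite /rising ler_prod // => i _; rewrite lerD2r ac addr_ge0 ?ler0n // ltW.
rewrite ler_norml -(has_sum_lim hs); apply/andP; split.
  apply: limr_ge; first by apply/cvg_ex; eexists; exact: hs.
  by apply: nearW => m; have := hp m; rewrite ler_norml => /andP[].
apply: limr_le; first by apply/cvg_ex; eexists; exact: hs.
by apply: nearW => m; have := hp m; rewrite ler_norml => /andP[].
Qed.

End Estimates.

(** * Real polynomials *)

Section RealPolynomials.
Variable R : realType.
Implicit Types (p q : {poly R}) (ts s : seq R).

(** [p] is a nonzero constant times a product of real factors ['X - t]. *)
Definition splits p := exists ts c,
  c != 0 /\ p = c *: \prod_(t <- ts) ('X - t%:P).

Lemma splits_neq0 p : splits p -> p != 0.
Proof.
move=> [ts [c [c0 ->]]]; rewrite scaler_eq0 negb_or c0 /=.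
by rewrite monic_neq0 // monic_prod_XsubC.
Qed.

Lemma splitsM p q : splits p -> splits q -> splits (p * q).
Proof.
move=> [ts [c [c0 ->]]] [us [d [d0 ->]]]; exists (ts ++ us), (c * d).
by rewrite mulf_neq0 // big_cat /= -scalerAl -scalerAr scalerA.
Qed.

Lemma splitsC (c : R) : c != 0 -> splits c%:P.
Proof. by move=> c0; exists [::], c; rewrite big_nil alg_polyC. Qed.

Lemma splits_affine (a b : R) : a != 0 -> splits (a *: 'X + b%:P).
Proof.
move=> a0; exists [:: - (b / a)], a; split=> //.
by rewrite big_seq1 scalerBr polyCN scalerN opprK
  -[a *: (b / a)%:P]mul_polyC -polyCM mulrCA divff // mulr1.
Qed.

Lemma splitsN p : splits p -> splits (- p).
Proof. by move=> h; rewrite -mulN1r -polyCN; apply: splitsM => //; apply: splitsC; rewrite oppr_eq0 oner_eq0. Qed.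

Lemma splitsX p n : splits p -> splits (p ^+ n).
Proof.
move=> h; elim: n => [|n IH]; first by apply: splitsC; exact: oner_neq0.
by rewrite exprS; exact: splitsM.
Qed.

(** ** Behaviour at infinity *)

Lemma poly_far_ge p : p != 0 ->
  exists M, forall w, M <= w -> `|lead_coef p| <= `|p.[w]|.
Proof.
move=> p0; have lc : 0 < lead_coef (p * p).
  by rewrite lead_coefM -expr2 exprn_even_gt0 //= lead_coef_eq0.
have [M hM] := poly_pinfty_gt_lc lc; exists M => w /hM.
rewrite lead_coefM hornerM -!expr2 -(real_normK (num_real (lead_coef p))) -(real_normK (num_real p.[w])).
by rewrite ler_pXn2r ?nnegrE.
Qed.

Lemma poly_far_neq0 p : p != 0 -> exists M, forall w, M <= w -> p.[w] != 0.
Proof.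
move=> p0; have [M hM] := poly_far_ge p0; exists M => w /hM h.
by rewrite -normr_gt0 (lt_le_trans _ h) // normr_gt0 lead_coef_eq0.
Qed.

Lemma poly_far_eq0 p (M : R) : (forall w, M <= w -> p.[w] = 0) -> p = 0.
Proof.
move=> h; apply/eqP; apply: contraT => /poly_far_neq0[N hN].
have := hN (Num.max M N); rewrite h ?eqxx ?le_max ?lexx ?orbT // => /(_ isT).
by [].
Qed.

Lemma poly_dominates p q (E : R) : (size q < size p)%N ->
  exists M, forall w, M <= w -> E * `|q.[w]| <= `|p.[w]|.
Proof.
move=> spq; have p0 : p != 0 by rewrite -size_poly_gt0 (leq_trans _ spq).
have lc : 0 < lead_coef (p * p - (E *: q) * (E *: q)).
  rewrite lead_coefDl; last first.
    rewrite size_polyN (leq_ltn_trans (size_polyMleq _ _)) // size_mul //.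
    move: spq (size_scale_leq E q).
    by move: (size (E *: q)) (size q) (size p) => k n m; lia.
  by rewrite lead_coefM -expr2 exprn_even_gt0 //= lead_coef_eq0.
have [M hM] := poly_pinfty_gt_lc lc; exists M => w /hM h.
have {}h : 0 <= (p * p - (E *: q) * (E *: q)).[w] by apply: le_trans h; exact: ltW.
move: h; rewrite hornerD hornerN !hornerM !hornerZ subr_ge0 -!expr2.
rewrite -(real_normK (num_real (E * _))) -(real_normK (num_real p.[w])) ler_pXn2r ?nnegrE // normrM.
by apply: le_trans; rewrite ler_wpM2r // ler_norm.
Qed.

(** ** Counting roots *)

(** A nonzero polynomial has at most as many roots, counted with multiplicity,
    as its degree. *)
Lemma sum_mup_le s p : uniq s -> p != 0 ->
  (\sum_(x <- s) mup x p <= (size p).-1)%N.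
Proof.
move=> us p0.
have dv : \prod_(x <- s) ('X - x%:P) ^+ mup x p %| p.
  elim: s us => [|x s IH] /=; first by rewrite big_nil dvd1p.
  move=> /andP[xs us]; rewrite big_cons Gauss_dvdp.
    by rewrite -mup_geq // leqnn IH.
  rewrite coprimep_sym; apply: coprimep_expr; rewrite coprimep_XsubC.
  elim: s xs {IH us} => [|y s IH]; first by rewrite big_nil root1.
  rewrite in_cons negb_or => /andP[xy xs]; rewrite big_cons rootM negb_or IH // andbT.
  case: (mup y p) => [|n]; first by rewrite expr0 root1.
  by rewrite root_exp_XsubC // eq_sym.
have := dvdp_leq p0 dv; suff -> : size (\prod_(x <- s) ('X - x%:P) ^+ mup x p) =
  (\sum_(x <- s) mup x p).+1 by move=> h; rewrite -ltnS (leq_trans h) // leqSpred.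
elim: s {us dv} => [|x s IH]; first by rewrite !big_nil size_poly1.
have A : ('X - x%:P) ^+ mup x p != 0 by rewrite expf_neq0 // polyXsubC_eq0.
have B : \prod_(x <- s) ('X - x%:P) ^+ mup x p != 0 by rewrite -size_poly_eq0 IH.
by rewrite !big_cons size_mul // IH size_exp_XsubC addSn addnS.
Qed.

Lemma count_mem_split ts s : uniq s -> {subset ts <= s} ->
  (\sum_(x <- s) count_mem x ts = size ts)%N.
Proof.
move=> us; elim: ts => [|t ts IH] h /=; first by rewrite big1.
rewrite big_split /= IH; last by move=> y yt; apply: h; rewrite in_cons yt orbT.
rewrite -add1n; congr (_ + _)%N; rewrite (bigD1_seq t) //=; last by apply: h; rewrite mem_head.
by rewrite eqxx big1 // => i /negPf it; rewrite eq_sym it.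
Qed.

(** The degree of a polynomial exceeds the size of [ts] if, in every class modulo
    the integers, it has at least as many roots as listed in [ts], and strictly
    more in one class. *)
Lemma count_roots ts p (L : R) (J : nat) (c0 : R) : p != 0 ->
  (forall t, t \in ts -> L <= t < L + J%:R) ->
  (forall c, L <= c < L + 1 ->
    (\sum_(j < J) count_mem (c + j%:R)%R ts <= \sum_(j < J) mup (c + j%:R)%R p)%N) ->
  L <= c0 < L + 1 ->
  (\sum_(j < J) count_mem (c0 + j%:R)%R ts < \sum_(j < J) mup (c0 + j%:R)%R p)%N ->
  (size ts < (size p).-1)%N.
Proof.
move=> p0 hts hc hc0 hlt.
(* [t = rep t + n_ t], with [rep t] the representative of the class of [t] in
   the interval starting at [L] *)
pose n_ (t : R) := Num.truncn (t - L).
pose rep (t : R) := t - (n_ t)%:R.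
have hrep t : t \in ts -> (L <= rep t < L + 1) /\ (n_ t < J)%N.
  move=> /hts/andP[t1 t2]; have := truncn_itv (_ : 0 <= t - L).
  rewrite subr_ge0 => /(_ t1)/andP[h1 h2]; rewrite -natr1 in h2; split.
    by rewrite /rep /n_; lra.
  by rewrite -(ltr_nat R); apply: le_lt_trans h1 _; lra.
pose cs := undup (c0 :: map rep ts).
have hcs c : c \in cs -> L <= c < L + 1.
  by rewrite mem_undup in_cons => /orP[/eqP->//|/mapP[t /hrep[h _] ->]].
pose pts := [seq c + j%:R | c <- cs, j <- iota 0 J].
have upts : uniq pts.
  apply: allpairs_uniq; [exact: undup_uniq|exact: iota_uniq|].
  move=> [c j] [c' j'] /allpairsP[[a b] /= [ha _ [-> ->]]].
  move=> /allpairsP[[a' b'] /= [ha' _ [-> ->]]] e.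
  have /andP[a1 a2] := hcs _ ha; have /andP[a3 a4] := hcs _ ha'.
  have lt1 : (b < b'.+1)%N by rewrite -(ltr_nat R) -natr1; lra.
  have lt2 : (b' < b.+1)%N by rewrite -(ltr_nat R) -natr1; lra.
  have bb : b = b' by apply/eqP; rewrite eqn_leq; apply/andP; split; rewrite -ltnS.
  by move: e; rewrite bb => /addIr ->.
have sub : {subset ts <= pts}.
  move=> t tt; apply/allpairsP; exists (rep t, n_ t) => /=.
  have [h1 h2] := hrep t tt; split; last by rewrite subrK.
    by rewrite mem_undup in_cons map_f ?orbT.
  by rewrite mem_iota.
apply: leq_trans (sum_mup_le upts p0).
rewrite -(count_mem_split upts sub) !big_allpairs_dep /=.
have c0s : c0 \in cs by rewrite mem_undup mem_head.
have ordE (f : nat -> nat) : (\sum_(j <- iota 0 J) f j = \sum_(j < J) f j)%N.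
  by rewrite -(big_mkord xpredT) /index_iota subn0.
rewrite (bigD1_seq c0) ?undup_uniq //= [X in (_ <= X)%N](bigD1_seq c0) ?undup_uniq //=.
rewrite -addSn leq_add //.
  rewrite (ordE (fun j => count_mem (c0 + j%:R)%R ts)).
  by rewrite (ordE (fun j => mup (c0 + j%:R)%R p)).
rewrite big_seq_cond [X in (_ <= X)%N]big_seq_cond leq_sum // => c /andP[cc _].
rewrite (ordE (fun j => count_mem (c + j%:R)%R ts)).
rewrite (ordE (fun j => mup (c + j%:R)%R p)).
exact: hc _ (hcs _ cc).
Qed.

End RealPolynomials.

(** * Orders of magnitude at [0+] *)

Section RightGerms.
Variable R : realType.
Implicit Types (P Q : R -> Prop) (f g : R -> R) (p q : {poly R}).

(** [P] holds on some interval [(0, eps)]. *)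
Definition near0 P := exists2 eps : R, 0 < eps & forall d, 0 < d < eps -> P d.

(** [g d = O(d^e)] as [d] tends to [0+]. *)
Definition rightO (e : nat) g := exists K, near0 (fun d => `|g d| <= K * d ^+ e).

Lemma near0I P Q : near0 P -> near0 Q -> near0 (fun d => P d /\ Q d).
Proof.
move=> [e e0 he] [f f0 hf]; exists (Num.min e f); first by rewrite lt_min e0.
move=> d /andP[d0]; rewrite lt_min => /andP[d1 d2].
by split; [apply: he|apply: hf]; rewrite d0.
Qed.

Lemma near0_imp P Q : near0 P -> (forall d, 0 < d -> P d -> Q d) -> near0 Q.
Proof.
by move=> [e e0 he] h; exists e => // d hd; apply: h; [case/andP: hd|exact: he].
Qed.

Lemma near0_lt (e : R) : 0 < e -> near0 (fun d => d < e).
Proof. by move=> e0; exists e => // d /andP[]. Qed.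

Lemma near0T P : (forall d, 0 < d -> P d) -> near0 P.
Proof. by move=> h; exists 1 => // d /andP[d0 _]; exact: h. Qed.

Lemma near0_ex P : near0 P -> exists2 d, 0 < d & P d.
Proof.
move=> [e e0 he]; exists (e / 2); first by lra.
by apply: he; lra.
Qed.

Lemma near0_all (n : nat) (P : nat -> R -> Prop) :
  (forall j, (j < n)%N -> near0 (P j)) ->
  near0 (fun d => forall j, (j < n)%N -> P j d).
Proof.
elim: n => [|n IH] h; first by exact: near0T.
have h1 := IH (fun j hj => h j (ltnW hj)).
apply: (near0_imp (near0I h1 (h n (ltnSn n)))) => d _ [h2 h3] j.
by rewrite ltnS leq_eqVlt => /orP[/eqP->|/h2].
Qed.

Lemma rightO_pos e g : rightO e g ->
  exists2 K, 0 < K & near0 (fun d => `|g d| <= K * d ^+ e).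
Proof.
move=> [K hK]; exists (`|K| + 1); first by rewrite ltr_wpDl.
apply: (near0_imp hK) => d d0 h; apply: (le_trans h).
by rewrite ler_wpM2r ?exprn_ge0 ?ltW // (le_lt_trans (ler_norm _)) // ltrDl.
Qed.

Lemma rightO_eq e f g : near0 (fun d => f d = g d) -> rightO e f -> rightO e g.
Proof.
move=> h [K hK]; exists K; apply: (near0_imp (near0I h hK)).
by move=> d _ [->].
Qed.

Lemma rightO_const c : rightO 0 (fun=> c).
Proof. by exists `|c|; apply: near0T => d _; rewrite expr0 mulr1. Qed.

Lemma rightO_id : rightO 0 id.
Proof.
exists 1; apply: (near0_imp (near0_lt ltr01)) => d d0 d1.
by rewrite expr0 mulr1 gtr0_norm // ltW.
Qed.

Lemma rightOD e f g : rightO e f -> rightO e g -> rightO e (fun d => f d + g d).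
Proof.
move=> [K hK] [L hL]; exists (K + L); apply: (near0_imp (near0I hK hL)).
by move=> d _ [h1 h2]; rewrite (le_trans (ler_normD _ _)) // mulrDl lerD.
Qed.

Lemma rightOM e e' f g : rightO e f -> rightO e' g ->
  rightO (e + e') (fun d => f d * g d).
Proof.
move=> [K hK] [L hL]; exists (K * L); apply: (near0_imp (near0I hK hL)).
move=> d _ [h1 h2]; rewrite normrM exprD mulrACA.
by rewrite ler_pM.
Qed.

Lemma rightON e f : rightO e f -> rightO e (fun d => - f d).
Proof. by move=> [K hK]; exists K; apply: (near0_imp hK) => d _; rewrite normrN. Qed.

Lemma rightOMl e f g : rightO 0 f -> rightO e g -> rightO e (fun d => f d * g d).
Proof. exact: rightOM. Qed.

(** A quotient of powers [d^m / d^n] is [O(d^e)] when [n + e <= m]. *)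
Lemma rightO_power (m n e : nat) : (n + e <= m)%N ->
  rightO e (fun d => d ^+ m / d ^+ n).
Proof.
move=> h; exists 1; apply: (near0_imp (near0_lt ltr01)) => d d0 d1.
have -> : m = (n + e + (m - (n + e)))%N by rewrite subnKC.
have dn : d ^+ n != 0 by rewrite expf_neq0 // gt_eqF.
have -> : d ^+ (n + e + (m - (n + e))) / d ^+ n = d ^+ e * d ^+ (m - (n + e)).
  by rewrite !exprD; field.
have d0' := ltW d0; rewrite mul1r ger0_norm ?mulr_ge0 ?exprn_ge0 //.
by rewrite ler_piMr ?exprn_ge0 // exprn_ile1 // ltW.
Qed.

Lemma rightO_affine (a s : R) : rightO 0 (fun d => a + s * d).
Proof.
apply: rightOD; first exact: rightO_const.
by apply: rightOMl; [exact: rightO_const|exact: rightO_id].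
Qed.

Lemma rightO_poly p c : rightO 0 (fun d => p.[c + d]).
Proof.
elim/poly_ind: p => [|p a IH].
  by apply: rightO_eq (rightO_const 0); apply: near0T => d _; rewrite horner0.
apply: (rightO_eq (f := fun d => p.[c + d] * (c + 1 * d) + a)).
  by apply: near0T => d _; rewrite hornerMXaddC mul1r.
apply: rightOD; last exact: rightO_const.
by apply: rightOMl => //; exact: rightO_affine.
Qed.

Lemma poly_near0_ge p c : p.[c] != 0 ->
  near0 (fun d => `|p.[c]| / 2 <= `|p.[c + d]|).
Proof.
move=> pc0; have /factor_theorem[q hq] : root (p - p.[c]%:P) c.
  by rewrite rootE hornerD hornerN hornerC subrr.
have e d : p.[c + d] = p.[c] + q.[c + d] * d.
  rewrite -{1}[p](subrK p.[c]%:P) hq hornerD hornerC hornerM hornerXsubC.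
  by rewrite addrAC subrr add0r addrC.
have [K K0 hK] := rightO_pos (rightO_poly q c).
have n0 : 0 < `|p.[c]| by rewrite normr_gt0.
have e0 : 0 < `|p.[c]| / 2 / K by rewrite !divr_gt0.
apply: (near0_imp (near0I hK (near0_lt e0))) => d d0 [h1 h2].
rewrite expr0 mulr1 in h1.
have h3 : `|q.[c + d] * d| <= `|p.[c]| / 2.
  rewrite normrM (gtr0_norm d0) (le_trans (ler_wpM2r (ltW d0) h1)) //.
  by rewrite mulrC -ler_pdivlMr // ltW.
rewrite e; have := lerB_normD p.[c] (q.[c + d] * d); lra.
Qed.

Lemma rightO_inv_poly p c : p.[c] != 0 -> rightO 0 (fun d => (p.[c + d])^-1).
Proof.
move=> pc0; exists (`|p.[c]| / 2)^-1.
apply: (near0_imp (poly_near0_ge pc0)) => d d0 h.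
have n0 : 0 < `|p.[c]| / 2 by rewrite divr_gt0 // normr_gt0.
by rewrite expr0 mulr1 normfV lef_pV2 // posrE // (lt_le_trans n0).
Qed.

Lemma mup_factor p c : p != 0 ->
  exists2 q, q.[c] != 0 & p = q * ('X - c%:P) ^+ mup c p.
Proof.
move=> p0; have := mup_geq c (mup c p) p0; rewrite leqnn => /esym/dvdpP[q hq].
exists q => //; apply/negP => /eqP/eqP; rewrite -rootE => /factor_theorem[q' hq'].
have := mup_leq c (mup c p) p0; rewrite leqnn => /esym/negP; apply.
by apply/dvdpP; exists q'; rewrite {1}hq {1}hq' exprS mulrA.
Qed.

Lemma near0_poly_neq0 p c : p != 0 -> near0 (fun d => p.[c + d] != 0).
Proof.
move=> p0; have [q qc ->] := mup_factor c p0.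
apply: (near0_imp (poly_near0_ge qc)) => d d0 h.
rewrite hornerM horner_exp hornerXsubC addrAC subrr add0r mulf_neq0 //.
  by rewrite -normr_gt0 (lt_le_trans _ h) // divr_gt0 // normr_gt0.
by rewrite expf_neq0 // gt_eqF.
Qed.

Lemma rightO_inv_affine (a s : R) : a != 0 -> rightO 0 (fun d => (a + s * d)^-1).
Proof.
move=> a0; have /rightO_inv_poly h : (s *: 'X + a%:P).[0] != 0.
  by rewrite hornerD hornerZ hornerX hornerC mulr0 add0r.
apply: rightO_eq h; apply: near0T => d _.
by rewrite hornerD hornerZ hornerX hornerC add0r addrC.
Qed.

(** A quotient of polynomials is [O(d^e)] when its order at [c] is at least
    [e]. *)
Lemma rightO_quotient p q c e : p != 0 -> q != 0 ->
  (mup c q + e <= mup c p)%N -> rightO e (fun d => p.[c + d] / q.[c + d]).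
Proof.
move=> p0 q0 h; have [p1 hp1 ep] := mup_factor c p0.
have [q1 hq1 eq] := mup_factor c q0.
apply: (rightO_eq (f := fun d => (p1.[c + d] * (q1.[c + d])^-1) *
    (d ^+ mup c p / d ^+ mup c q))); last first.
  apply: rightOMl; last exact: rightO_power.
  by apply: rightOMl; [exact: rightO_poly|exact: rightO_inv_poly].
apply: near0T => d _; rewrite [in RHS]ep [in RHS]eq !hornerM !horner_exp.
by rewrite !hornerXsubC addrAC subrr add0r invfM mulrACA.
Qed.

End RightGerms.

(** * Growth of the Gauss series along a line of parameters *)

Section Lines.
Variables (R : realType) (x p q r : R).
Hypotheses (hx : 0 < x < 1) (p0 : 0 < p) (r0 : 0 < r).
Implicit Types (a b c : R).

Let x0 : 0 < x. Proof. by case/andP: hx. Qed.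
Let x1 : x < 1. Proof. by case/andP: hx. Qed.
Let x1' : 1 - x != 0. Proof. by rewrite subr_eq0 gt_eqF. Qed.
Let S := summable_gaussR hx.

(** The point at [d] of the line through [(a, b, c)] of direction [(p, q, r)]. *)
Definition near_par a b c (d : R) : par R :=
  Par (a + p * d) (b + q * d) (c + r * d).

Lemma near0_pos a s : 0 < a -> near0 (fun d : R => 0 < a + s * d).
Proof.
move=> a0; have s1 : 0 < `|s| + 1 by rewrite ltr_wpDl.
have e0 : 0 < a / (`|s| + 1) by rewrite divr_gt0.
apply: (near0_imp (near0_lt e0)) => d d0; rewrite ltr_pdivlMr // => h.
have : - (s * d) <= `|s| * d by rewrite -mulNr ler_wpM2r ?(ltW d0) // ler_normr lexx orbT.
lra.
Qed.

Lemma archi_neg a : exists n : nat, - n%:R <= a.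
Proof.
exists (Num.bound `|a|); rewrite lerNl (le_trans (ler_norm _)) // normrN ltW //.
exact: archi_boundP.
Qed.

Lemma near0_regular c : near0 (fun d => regular (c + r * d)).
Proof.
have pos c' : 0 <= c' -> near0 (fun d => regular (c' + r * d)).
  by move=> h; apply: near0T => d d0; apply: regular_gt0; rewrite ltr_wpDl // mulr_gt0.
have [n hn] := archi_neg c.
elim: n c hn => [|n IH] c hn; first by apply: pos; rewrite oppr0 in hn.
have [c0|c0] := leP 0 c; first exact: pos.
have h1 := IH (c + 1) (_ : - n%:R <= c + 1).
have e0 : 0 < - c / r by rewrite divr_gt0 // oppr_gt0.
apply: (near0_imp (near0I (h1 _) (near0_lt e0))).
  by move: hn; rewrite -natr1; lra.
move=> d d0 [h2]; rewrite ltr_pdivlMr // mulrC => h3 [|k].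
  by rewrite addr0 lt_eqF //; lra.
by have := h2 k; rewrite -natr1 (addrAC c 1) -(addrA (c + _)) [1 + _]addrC.
Qed.

(** Orders of magnitude propagate along a step whose denominator is bounded
    away from zero. *)
Section Step.
Variables (s : step) (a b c a' b' c' : R) (e : nat).
Hypothesis es : forall d, pshift s (near_par a b c d) = near_par a' b' c' d.
Hypothesis hden : rightO 0 (fun d => (den x s (near_par a b c d))^-1).
Hypothesis hden0 : near0 (fun d => den x s (near_par a b c d) != 0).
Hypothesis h11 : rightO 0 (fun d => m11 (mat x s (near_par a b c d))).
Hypothesis h12 : rightO 0 (fun d => m12 (mat x s (near_par a b c d))).
Hypothesis h21 : rightO 0 (fun d => m21 (mat x s (near_par a b c d))).
Hypothesis h22 : rightO 0 (fun d => m22 (mat x s (near_par a b c d))).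
Hypothesis hF : rightO e (fun d => gauss x (near_par a b c d)).
Hypothesis hG : rightO e (fun d => gauss1 x (near_par a b c d)).

Lemma rightO_step : rightO e (fun d => gauss x (near_par a' b' c' d)) /\
  rightO e (fun d => gauss1 x (near_par a' b' c' d)).
Proof.
have reg := near0I (near0I (near0_regular c) (near0_regular c')) hden0.
have key d : (regular (c + r * d) /\ regular (c' + r * d)) /\
    den x s (near_par a b c d) != 0 ->
  gauss x (near_par a' b' c' d) = (den x s (near_par a b c d))^-1 *
    (m11 (mat x s (near_par a b c d)) * gauss x (near_par a b c d) +
     m12 (mat x s (near_par a b c d)) * gauss1 x (near_par a b c d)) /\
  gauss1 x (near_par a' b' c' d) = (den x s (near_par a b c d))^-1 *
    (m21 (mat x s (near_par a b c d)) * gauss x (near_par a b c d) +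
     m22 (mat x s (near_par a b c d)) * gauss1 x (near_par a b c d)).
  move=> [[h1 h2] h3].
  have [] := @contiguity_step R x x1' S s (near_par a b c d) h1 _.
    by rewrite es.
  by rewrite es => <- <-; rewrite !mulKf.
split.
  apply: rightO_eq (near0_imp reg (fun d _ h => esym (key d h).1)) _.
  by apply: rightOMl => //; apply: rightOD; apply: rightOMl.
apply: rightO_eq (near0_imp reg (fun d _ h => esym (key d h).2)) _.
by apply: rightOMl => //; apply: rightOD; apply: rightOMl.
Qed.

End Step.

Lemma near0_affine_neq0 a s : a != 0 -> near0 (fun d : R => a + s * d != 0).
Proof.
rewrite neq_lt => /orP[a0|/(near0_pos s) h]; last first.
  by apply: (near0_imp h) => d _ /gt_eqF ->.
have := near0_pos (- s) (_ : 0 < - a); rewrite oppr_gt0 => /(_ a0) h.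
by apply: (near0_imp h) => d _ h2; rewrite lt_eqF //; lra.
Qed.

(** Nothing is assumed if [e = 1]; if [e = 0], then [c] is a nonpositive integer
    while [a] is not. *)
Definition order_cond (e : nat) a c := e = 1%N \/
  (e = 0%N /\ (exists m : nat, c + m%:R = 0) /\ forall n : nat, a + n%:R != 0).

Lemma order_condSa e a c : order_cond e a c -> order_cond e (a + 1) c.
Proof.
move=> [->|[-> [h1 h2]]]; first by left.
by right; split=> //; split=> // n; rewrite -addrA nat1r.
Qed.

Lemma order_condSc e a c : c < 0 -> order_cond e a c -> order_cond e a (c + 1).
Proof.
move=> c0 [->|[-> [[m hm] h2]]]; first by left.
right; split=> //; split=> //; case: m hm => [|m] hm.
  by move: hm c0; rewrite addr0 => ->; rewrite ltxx.
by exists m; rewrite -addrA nat1r.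
Qed.

(** For [a, c >= 0] and [b > 0] the series is at least 1, and tends to infinity
    if [c = 0 < a]. *)
Lemma not_rightO_base e a b c : 0 <= a -> 0 < b -> 0 <= c -> order_cond e a c ->
  ~ rightO e (fun d => gauss x (near_par a b c d)).
Proof.
move=> a0 b0 c0 he hF.
have hb := near0_pos q b0; have [K K0 hK] := rightO_pos hF.
have pos d : 0 < d -> 0 < b + q * d ->
    [/\ 0 <= a + p * d, 0 <= b + q * d & 0 < c + r * d].
  move=> d0 bd; have h1 := mulr_gt0 p0 d0; have h2 := mulr_gt0 r0 d0.
  by split; lra.
case: he => [e1|[e0 [[m hm] ha]]]; subst e.
  have K1 : 0 < K^-1 by rewrite invr_gt0.
  have [d d0 [[h1 h2] h3]] := near0_ex (near0I (near0I hb hK) (near0_lt K1)).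
  have [p1 p2 p3] := pos d d0 h1.
  have := gauss_ge1 hx (z := near_par a b c d) p1 p2 p3.
  move: h2; rewrite expr1 => h2 h4.
  have := le_trans (le_trans h4 (ler_norm _)) h2.
  by rewrite leNgt -ltr_pdivlMl // mulr1 h3.
have c00 : c = 0.
  by apply/eqP; rewrite eq_le c0 andbT -hm lerDl ler0n.
have a00 : 0 < a by rewrite lt_neqAle a0 eq_sym andbT; have := ha 0%N; rewrite addr0.
have hb2 := near0_pos q (_ : 0 < b / 2).
have h5 : 0 < a * (b / 2) / r * x / K.
  by rewrite !(mulr_gt0, divr_gt0, invr_gt0).
have b20 : 0 < b / 2 by rewrite divr_gt0.
have [d d0 [[[h1 h2] h3] h4]] :=
  near0_ex (near0I (near0I (near0I hb hK) (near0_lt h5)) (hb2 b20)).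
have [p1 p2 p3] := pos d d0 h1.
have := gauss_ge_linear hx (z := near_par a b c d) p1 p2 p3 => /= h6.
move: h2; rewrite expr0 mulr1 => h2.
have h7 := le_trans (le_trans h6 (ler_norm _)) h2.
have h8 : a * (b / 2) * x <= K * (r * d).
  move: h7 h4 p3; rewrite c00 add0r => h7 h4 p3.
  rewrite -ler_pdivrMr //; apply: le_trans h7; rewrite mulrAC.
  rewrite ler_pM2r // ler_pM2r ?invr_gt0 // ler_pM //; [exact: ltW| |lra].
  by rewrite lerDl ltW // mulr_gt0.
have h9 : d < a * (b / 2) * x / (K * r).
  by rewrite (lt_le_trans h3) // le_eqVlt; apply/orP; left; apply/eqP; field;
    rewrite !gt_eqF.
rewrite ltr_pdivlMr ?mulr_gt0 // in h9.
have : d * (K * r) = K * (r * d) by ring.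
lra.
Qed.

Lemma not_rightO_a_ge0 e a b c : 0 <= a -> 0 < b -> order_cond e a c ->
  rightO e (fun d => gauss x (near_par a b c d)) ->
  rightO e (fun d => gauss1 x (near_par a b c d)) -> False.
Proof.
move=> a0 b0; have [n hn] := archi_neg c.
elim: n c hn => [|n IH] c hn he hF hG.
  by apply: not_rightO_base hF => //; rewrite oppr0 in hn.
have [c0|c0] := leP 0 c; first by apply: not_rightO_base hF.
have ca : c - a != 0 by rewrite lt_eqF //; lra.
have cb : c - b != 0 by rewrite lt_eqF //; lra.
have denE d : den x Sc (near_par a b c d) =
   - x * (((c - a) + (r - p) * d) * ((c - b) + (r - q) * d)) by rewrite /=; ring.
have aff s t : rightO 0 (fun d => s + t * d) by exact: rightO_affine.
have cst s : rightO 0 (fun=> s : R) by exact: rightO_const.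
have [] := @rightO_step Sc a b c a b (c + 1) e _ _ _ _ _ _ _ hF hG.
- by move=> d; rewrite /near_par /=; congr Par; ring.
- apply: (rightO_eq (f := fun d => - x^-1 * (((c - a) + (r - p) * d)^-1 *
     ((c - b) + (r - q) * d)^-1))).
    apply: near0T => d _; rewrite denE !invfM invrN; ring.
  by do 2![apply: rightOMl => //]; exact: rightO_inv_affine.
- have h1 := near0_affine_neq0 (r - p) ca; have h2 := near0_affine_neq0 (r - q) cb.
  apply: (near0_imp (near0I h1 h2)) => d _ [h3 h4].
  by rewrite denE !mulf_neq0 // oppr_eq0 gt_eqF.
1-4: rewrite /=.
- apply: rightOMl => //; repeat first [exact: aff|exact: cst|apply: rightOD|apply: rightON|apply: rightOMl].
- apply: rightOMl => //; repeat first [exact: aff|exact: cst|apply: rightOD|apply: rightON|apply: rightOMl].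
- apply: rightOMl => //; repeat first [exact: aff|exact: cst|apply: rightOD|apply: rightON|apply: rightOMl].
- apply: rightOMl => //; repeat first [exact: aff|exact: cst|apply: rightOD|apply: rightON|apply: rightOMl].
apply: IH; last exact: order_condSc.
by move: hn; rewrite -natr1; lra.
Qed.

(** On a line with [b > 0] at [d = 0], the vector [(F, theta F)] is not [O(d)],
    and it is unbounded if [c] is a nonpositive integer and [a] is not one:
    raising [a] and then [c] until they are nonnegative never meets a factor
    vanishing at [d = 0], and leads to the case of [not_rightO_base]. *)
Lemma not_rightO e a b c : 0 < b -> order_cond e a c ->
  rightO e (fun d => gauss x (near_par a b c d)) ->
  rightO e (fun d => gauss1 x (near_par a b c d)) -> False.
Proof.
move=> b0; have [n hn] := archi_neg a.
elim: n a hn => [|n IH] a hn he hF hG.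
  by apply: not_rightO_a_ge0 hF hG => //; rewrite oppr0 in hn.
have [a0|a0] := leP 0 a; first by apply: not_rightO_a_ge0 hF hG.
have a0' : a != 0 by rewrite lt_eqF.
have aff s t : rightO 0 (fun d => s + t * d) by exact: rightO_affine.
have cst s : rightO 0 (fun=> s : R) by exact: rightO_const.
have [] := @rightO_step Sa a b c (a + 1) b c e _ _ _ _ _ _ _ hF hG.
- by move=> d; rewrite /near_par /=; congr Par; ring.
- apply: (rightO_eq (f := fun d => (1 - x)^-1 * (a + p * d)^-1)).
    by apply: near0T => d _; rewrite /= invfM.
  by apply: rightOMl => //; exact: rightO_inv_affine.
- by apply: (near0_imp (near0_affine_neq0 p a0')) => d _ h; rewrite /= mulf_neq0.
1-4: rewrite /=; repeat first [exact: aff|exact: cst|apply: rightOD|apply: rightON|apply: rightOMl].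
apply: IH; last exact: order_condSa.
by move: hn; rewrite -natr1; lra.
Qed.

End Lines.

(** * Contiguity along a line of parameters *)

Section AffineParameters.
Variables (R : realType) (x p q r : R).
Hypotheses (x0 : x != 0) (x1 : 1 - x != 0).
Hypotheses (p0 : p != 0) (q0 : q != 0) (r0 : r != 0).
Hypotheses (pr : p - r != 0) (qr : q - r != 0).

(** Parameters that are affine functions of the variable, of slopes [p], [q] and
    [r]. *)
Definition affine_par (a b c : R) : par {poly R} :=
  Par (p *: 'X + a%:P) (q *: 'X + b%:P) (r *: 'X + c%:P).

Lemma affine_shift s a b c : exists a' b' c',
  pshift s (affine_par a b c) = affine_par a' b' c'.
Proof.
case: s; rewrite /pshift /affine_par /=.
- by exists (a + 1), b, c; rewrite polyCD addrA.
- by exists a, (b - 1), c; rewrite polyCB addrA.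
- by exists a, b, (c + 1); rewrite polyCD addrA.
- by exists a, b, (c - 1); rewrite polyCB addrA.
Qed.

Lemma splits_diff (s t u v : R) : s - t != 0 ->
  splits ((s *: 'X + u%:P) - (t *: 'X + v%:P)).
Proof.
move=> st; have -> : (s *: 'X + u%:P) - (t *: 'X + v%:P) =
    (s - t) *: 'X + (u - v)%:P :> {poly R}.
  by rewrite scalerBl polyCB opprD addrACA.
exact: splits_affine.
Qed.

Lemma splits_sub1 (s u : R) : s != 0 -> splits (s *: 'X + u%:P - 1).
Proof. by move=> h; rewrite -addrA -polyCB; exact: splits_affine. Qed.

Let rp' : r - p != 0. Proof. by rewrite -oppr_eq0 opprB. Qed.
Let rq' : r - q != 0. Proof. by rewrite -oppr_eq0 opprB. Qed.

Lemma splits_1x : splits (1 - x%:P).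
Proof. by rewrite -polyCB; exact: splitsC. Qed.

(** All the factors below are affine of slope [p], [q], [r], [p - r] or [q - r],
    up to sign, or nonzero constants. *)
Lemma splits_den s a b c : splits (den x%:P s (affine_par a b c)).
Proof.
have := splits_1x; have := splitsC x0; have := rp'; have := rq'.
case: s => /= ? ? ? ?.
- by apply: splitsM => //; exact: splits_affine.
- by apply: splitsM; [exact: splits_sub1|exact: splits_diff].
- by apply: splitsN; apply: splitsM => //; apply: splitsM; exact: splits_diff.
- by apply: splitsM => //; exact: splits_sub1.
Qed.

Lemma splits_det s a b c : s <> Sg ->
  splits (det2 (mat x%:P s (affine_par a b c))).
Proof.
rewrite det_matE; have := splits_1x; have := splitsC x0; have := rp'; have := rq'.
case: s => //= ? ? ? ? _.
- apply: splitsM; first by apply: splitsM => //; exact: splits_affine.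
  have -> : p *: 'X + a%:P - (r *: 'X + c%:P) + 1 =
     (p *: 'X + (a + 1)%:P) - (r *: 'X + c%:P) :> {poly R} by rewrite polyCD; ring.
  exact: splits_diff.
- apply: splitsM; first by apply: splitsX; exact: splits_sub1.
  apply: splitsM; last exact: splits_diff.
  by apply: splitsM => //; exact: splits_sub1.
- apply: splitsM; first by apply: splitsX; exact: splits_affine.
  by apply: splitsN; do 2![apply: splitsM; last exact: splits_diff]; exact: splitsM.
Qed.

Lemma splits_dual_scalar s a b c : s <> Sg ->
  splits (dual_scalar x%:P s (affine_par a b c)).
Proof.
have := splits_1x; have := splitsC x0; have := rp'; have := rq'.
case: s => //= ? ? ? ? _.
- apply: splitsN; apply: splitsM; first by apply: splitsM => //; exact: splits_affine.
  have -> : p *: 'X + a%:P - (r *: 'X + c%:P) + 1 =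
     (p *: 'X + (a + 1)%:P) - (r *: 'X + c%:P) :> {poly R} by rewrite polyCD; ring.
  exact: splits_diff.
- apply: splitsM; last exact: splits_diff.
  by apply: splitsM => //; apply: splitsX; exact: splits_sub1.
- apply: splitsN; do 2![apply: splitsM; last exact: splits_diff].
  apply: splitsM; last exact: splits_sub1.
  apply: splitsM; last exact: splits_affine.
  exact: splitsM.
Qed.

Lemma splits_recip_scalar2 s a b c : s <> Sg ->
  splits (recip_scalar2 s (affine_par a b c)).
Proof.
case: s => //= _; first by apply: splitsC; exact: oner_neq0.
- exact: splits_sub1.
- exact: splits_affine.
Qed.

Lemma splits_dens ws a b c : splits (dens x%:P ws (affine_par a b c)).
Proof.
elim: ws a b c => [|s ws IH] a b c /=; first by apply: splitsC; exact: oner_neq0.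
have [a' [b' [c' ->]]] := affine_shift s a b c.
by apply: splitsM; [exact: IH|exact: splits_den].
Qed.

Lemma splits_dets ws a b c : no_Sg ws ->
  splits (det2 (mats x%:P ws (affine_par a b c))).
Proof.
elim: ws a b c => [|s ws IH] a b c /=.
  by rewrite /det2 /= mulr1 mulr0 subr0 => _; apply: splitsC; exact: oner_neq0.
move=> /andP[hs hws]; rewrite det2M.
have [a' [b' [c' ->]]] := affine_shift s a b c.
by apply: splitsM; [exact: IH|apply: splits_det; case: s hs].
Qed.

Lemma splits_dual_scalars ws a b c : no_Sg ws ->
  splits (dual_scalars x%:P ws (affine_par a b c)).
Proof.
elim: ws a b c => [|s ws IH] a b c /=.
  by move=> _; apply: splitsC; exact: oner_neq0.
move=> /andP[hs hws].
have [a' [b' [c' ->]]] := affine_shift s a b c.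
by apply: splitsM; [exact: IH|apply: splits_dual_scalar; case: s hs].
Qed.

Lemma splits_recip_scalars2 ws a b c : no_Sg ws ->
  splits (recip_scalars2 ws (affine_par a b c)).
Proof.
elim: ws a b c => [|s ws IH] a b c /=.
  by move=> _; apply: splitsC; exact: oner_neq0.
move=> /andP[hs hws].
have [a' [b' [c' ->]]] := affine_shift s a b c.
by apply: splitsM; [exact: IH|apply: splits_recip_scalar2; case: s hs].
Qed.

Lemma affine_horner a b c w : map_par (horner_eval w) (affine_par a b c) =
  Par (p * w + a) (q * w + b) (r * w + c).
Proof. by rewrite /map_par /affine_par /= /horner_eval !hornerE. Qed.

End AffineParameters.

(** The chain of steps from [w] to [w + 1], for
    [(a, b, c) = (n1 w + a0, - n2 w + b0, n3 w)]. *)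
Definition unit_word (n1 n2 n3 : nat) : seq step :=
  nseq n1 Sa ++ nseq n2 Sb ++ nseq n3 Sc.

Section Words.
Variable A : comNzRingType.
Implicit Types z : par A.

Lemma pshifts_nseq s n z : pshifts (nseq n s) z =
  match s with
  | Sa => Par (pa z + n%:R) (pb z) (pc z)
  | Sb => Par (pa z) (pb z - n%:R) (pc z)
  | Sc => Par (pa z) (pb z) (pc z + n%:R)
  | Sg => Par (pa z) (pb z) (pc z - n%:R)
  end.
Proof.
elim: n z => [|n IH] z; first by case: s; case: z => * /=; rewrite ?addr0 ?subr0.
rewrite /= IH; case: s {IH}; case: z => ? ? ? /=; congr (Par _ _ _); rewrite -nat1r; ring.
Qed.

Lemma pshifts_unit n1 n2 n3 z : pshifts (unit_word n1 n2 n3) z =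
  Par (pa z + n1%:R) (pb z - n2%:R) (pc z + n3%:R).
Proof. by rewrite /unit_word !shifts_cat !pshifts_nseq. Qed.

Lemma no_Sg_cat ws1 ws2 : no_Sg (ws1 ++ ws2) = no_Sg ws1 && no_Sg ws2.
Proof. by elim: ws1 => //= s ws1 ->; rewrite andbA. Qed.

Lemma no_Sg_unit n1 n2 n3 : no_Sg (unit_word n1 n2 n3).
Proof.
by rewrite /unit_word !no_Sg_cat; apply/and3P; split;
  [elim: n1|elim: n2|elim: n3].
Qed.

End Words.

Lemma regulars_no_Sg (K : numFieldType) ws (z : par K) : no_Sg ws ->
  regular (pc z) -> regulars ws z.
Proof.
elim: ws z => [|s ws IH] z //= /andP[hs hws] hc; split=> //.
by apply: IH => //; case: s hs => //= _; exact: regular1.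
Qed.

(** * Rational ratios come from contiguity relations *)

Section Shifts.
Variable R : realType.
Implicit Types (p q : {poly R}).

(** The polynomial [p(X + j)]. *)
Definition translate p (j : R) := p \Po ('X + j%:P).

Lemma translateE p j w : (translate p j).[w] = p.[w + j].
Proof. by rewrite horner_comp hornerD hornerX hornerC. Qed.

Lemma translate_eq0 p j : (translate p j == 0) = (p == 0).
Proof. by rewrite comp_poly2_eq0 // size_XaddC. Qed.

Lemma mup_translate p j c : p != 0 -> mup c (translate p j) = mup (c + j) p.
Proof.
move=> p0; have [q qc ep] := mup_factor (c + j) p0.
rewrite {1}ep /translate comp_polyM rmorphXn /= comp_polyB comp_polyX comp_polyC.
have -> : 'X + j%:P - (c + j)%:P = 'X - c%:P :> {poly R} by rewrite polyCD; ring.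
rewrite mupMr; last by rewrite rootE -/(translate q j) translateE.
by rewrite mup_XsubCX eqxx.
Qed.

Lemma mup_translates p c J : p != 0 ->
  mup c (\prod_(j < J) translate p j%:R) = (\sum_(j < J) mup (c + j%:R)%R p)%N.
Proof.
move=> p0; elim: J => [|J IH].
  by rewrite !big_ord0 mupNroot // root1.
rewrite !big_ord_recr /= mupM ?IH ?mup_translate ?translate_eq0 //.
by apply/prodf_neq0 => i _; rewrite translate_eq0.
Qed.

Lemma coprimep_translate p q j : coprimep p q ->
  coprimep (translate p j) (translate q j).
Proof.
move=> /Bezout_eq1_coprimepP[[u v] /= e]; apply/Bezout_eq1_coprimepP.
exists (translate u j, translate v j) => /=.
by rewrite /translate -!comp_polyM -comp_polyD e -[1]/(1%:P) comp_polyC.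
Qed.

End Shifts.

Section Rigidity.
Variables (R : realType) (x a b : R) (n1 n2 n3 : nat).
Hypotheses (hx : 0 < x < 1) (hn1 : (0 < n1)%N) (hn13 : (n1 < n3)%N) (hn2 : (0 < n2)%N).

Let p : R := n1%:R.
Let q : R := - n2%:R.
Let r : R := n3%:R.
Let x0 : 0 < x. Proof. by case/andP: hx. Qed.
Let x1 : x < 1. Proof. by case/andP: hx. Qed.
Let x0' : x != 0. Proof. by rewrite gt_eqF. Qed.
Let x1' : 1 - x != 0. Proof. by rewrite subr_eq0 gt_eqF. Qed.
Let p0 : 0 < p. Proof. by rewrite ltr0n. Qed.
Let q0 : q < 0. Proof. by rewrite oppr_lt0 ltr0n. Qed.
Let pr : p < r. Proof. by rewrite ltr_nat. Qed.
Let r0 : 0 < r. Proof. exact: lt_trans pr. Qed.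
Let p0' : p != 0. Proof. by rewrite gt_eqF. Qed.
Let q0' : q != 0. Proof. by rewrite lt_eqF. Qed.
Let r0' : r != 0. Proof. by rewrite gt_eqF. Qed.
Let pr' : p - r != 0. Proof. by rewrite subr_eq0 lt_eqF. Qed.
Let qr' : q - r != 0. Proof. by rewrite subr_eq0 lt_eqF // (lt_trans q0). Qed.
Let S_ := summable_gaussR hx.

(** The contiguity relation between [w] and [w + 1], with polynomial
    coefficients in [w]. *)
Definition unit_par : par {poly R} := affine_par p q r a b 0.
Definition unit_den : {poly R} := dens x%:P (unit_word n1 n2 n3) unit_par.
Definition unit_mx : mat2 {poly R} := mats x%:P (unit_word n1 n2 n3) unit_par.

Let zz (w : R) : par R := Par (p * w + a) (q * w + b) (r * w).
Let F (w : R) := gauss x (zz w).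
Let G (w : R) := gauss1 x (zz w).
Let D := unit_den.
Let N := unit_mx.

(* [F] and [G] are the series and its [theta]-derivative, as functions of a real
   [w]. *)
Let contig w : regular (r * w) ->
  D.[w] * F (w + 1) = (m11 N).[w] * F w + (m12 N).[w] * G w /\
  D.[w] * G (w + 1) = (m21 N).[w] * F w + (m22 N).[w] * G w.
Proof.
move=> hc; have hr : regulars (unit_word n1 n2 n3) (zz w).
  by apply: regulars_no_Sg => //; exact: no_Sg_unit.
have := contiguity x1' S_ hr.
have <- : map_par (horner_eval w) unit_par = zz w.
  by rewrite affine_horner addr0.
have ex : x = horner_eval w x%:P by rewrite /horner_eval hornerC.
rewrite {1 2}ex -map_dens -map_mats -map_pshifts /F /G.
have -> : zz (w + 1) = map_par (horner_eval w) (pshifts (unit_word n1 n2 n3) unit_par).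
  rewrite map_pshifts pshifts_unit affine_horner /zz /=.
  by congr (Par _ _ _); rewrite /p /q /r; ring.
have -> : zz w = map_par (horner_eval w) unit_par.
  by rewrite affine_horner addr0.
by [].
Qed.

Let D0 : splits D. Proof. exact: splits_dens. Qed.
Let detN0 : det2 N != 0.
Proof. by apply: splits_neq0; apply: splits_dets => //; exact: no_Sg_unit. Qed.

Lemma far_line s t u : 0 < s -> exists M, forall w : R, M <= w -> u <= s * w + t.
Proof.
move=> s0; exists ((u - t) / s) => w; rewrite ler_pdivrMr // => h.
by rewrite -lerBlDr mulrC.
Qed.

Let far_par : exists M, forall w, M <= w ->
  [/\ 0 < p * w + a, p * w + a + 1 <= r * w, q * w + b <= 1 & 0 < r * w].
Proof.
have [M1 h1] := far_line a 1 p0.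
have rp0 : 0 < r - p by rewrite subr_gt0.
have [M2 h2] := far_line (- a) 1 rp0.
have nq0 : 0 < - q by rewrite oppr_gt0.
have [M3 h3] := far_line (- b) 0 nq0.
have [M4 h4] := far_line 0 1 r0.
exists (Num.max (Num.max M1 M2) (Num.max M3 M4)) => w.
rewrite !ge_max => /andP[/andP[/h1 g1 /h2 g2] /andP[/h3 g3 /h4 g4]]; split; lra.
Qed.

Lemma far_pos : exists M, forall w, M <= w -> 0 < F w /\ regular (r * w).
Proof.
have [M hM] := far_par; exists M => w /hM[h1 h2 h3 h4].
by split; [exact: gauss_gt0|exact: regular_gt0].
Qed.

Section Contradiction.
Variables P Q : {poly R}.
Hypothesis Q0 : Q != 0.
Hypothesis hPQ : exists M, forall w, M <= w -> Q.[w] * F (w + 1) = P.[w] * F w.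
Hypothesis V0 : m12 N != 0.

(** [(F, G)] is a multiple of a primitive vector [(S, T)] of polynomials, which
    [N] maps to a multiple of its translate. *)
Let line_exists : exists S T mu : {poly R},
  [/\ S != 0, forall w, (m11 N).[w] * S.[w] + (m12 N).[w] * T.[w] =
         mu.[w] * S.[w + 1],
      forall w, (m21 N).[w] * S.[w] + (m22 N).[w] * T.[w] =
         mu.[w] * T.[w + 1] &
      exists M, forall w, M <= w -> S.[w] * G w = T.[w] * F w].
Proof.
(* Eliminating [F (w + 1)] between the rational ratio and the contiguity relation
   gives [S0 G = T0 F]. *)
pose S0 := Q * m12 N; pose T0 := D * P - Q * m11 N.
have S00 : S0 != 0 by rewrite mulf_neq0.
pose g := gcdp S0 T0; have g0 : g != 0 by rewrite gcdp_eq0 negb_and S00.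
pose S := S0 %/ g; pose T := T0 %/ g.
have eS : S0 = S * g by rewrite divpK // dvdp_gcdl.
have eT : T0 = T * g by rewrite divpK // dvdp_gcdr.
have Sn0 : S != 0 by apply: contraNneq S00 => h; rewrite eS h mul0r.
have cST : coprimep S T.
  by apply: coprimep_div_gcd; rewrite S00.
have [M1 h1] := far_pos; have [M2 h2] := hPQ; have [M3 h3] := poly_far_neq0 g0.
have rel : exists M, forall w, M <= w -> S.[w] * G w = T.[w] * F w.
  exists (Num.max (Num.max M1 M2) M3) => w.
  rewrite !ge_max => /andP[/andP[/h1[_ hr] /h2 e] /h3 gw].
  have [e1 _] := contig hr; apply: (mulIf gw).
  have -> : S.[w] * G w * g.[w] = S0.[w] * G w by rewrite eS hornerM; ring.
  have -> : T.[w] * F w * g.[w] = T0.[w] * F w by rewrite eT hornerM; ring.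
  rewrite /S0 /T0 !hornerE.
  transitivity (Q.[w] * (D.[w] * F (w + 1)) - Q.[w] * (m11 N).[w] * F w).
    by rewrite e1; ring.
  by rewrite mulrCA e; ring.
(* [(E1, E2) = N (S, T)] is proportional to the translate [(S1, T1)], which is
   primitive. *)
pose E1 := m11 N * S + m12 N * T; pose E2 := m21 N * S + m22 N * T.
pose S1 := translate S 1; pose T1 := translate T 1.
have [M4 h4] := rel; have [M5 h5] := poly_far_neq0 Sn0.
have [M6 h6] := poly_far_neq0 (splits_neq0 D0).
have cross : S1 * E2 = T1 * E1.
  apply/eqP; rewrite -subr_eq0; apply/eqP.
  apply: (@poly_far_eq0 _ _ (Num.max (Num.max M1 M4) (Num.max M5 M6))) => w.
  rewrite !ge_max => /andP[/andP[h1' h4'] /andP[h5' h6']].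
  have [Fp hr] := h1 w h1'; have e := h4 w h4'.
  have w1 : w <= w + 1 by rewrite lerDl.
  have e' := h4 (w + 1) (le_trans h4' w1).
  have [c1 c2] := contig hr; have Sw := h5 w h5'.
  have k1 : S.[w] * (D.[w] * F (w + 1)) = F w * E1.[w].
    rewrite c1 mulrDr (mulrCA _ _ (G w)) e /E1 hornerD !hornerM. ring.
  have k2 : S.[w] * (D.[w] * G (w + 1)) = F w * E2.[w].
    by rewrite c2 mulrDr (mulrCA _ _ (G w)) e /E2 hornerD !hornerM; ring.
  have Fn : F w != 0 by rewrite gt_eqF.
  rewrite hornerD hornerN !hornerM !translateE; apply: (mulfI Fn); rewrite mulr0.
  transitivity (S.[w + 1] * (F w * E2.[w]) - T.[w + 1] * (F w * E1.[w])); first by ring.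
  rewrite -k1 -k2.
  transitivity (S.[w] * D.[w] * (S.[w + 1] * G (w + 1) - T.[w + 1] * F (w + 1))).
    by ring.
  by rewrite e' subrr mulr0.
have S10 : S1 != 0 by rewrite translate_eq0.
have /dvdpP[mu eE1] : S1 %| E1.
  rewrite -(@Gauss_dvdpr _ _ T1); last exact: coprimep_translate.
  by rewrite -cross dvdp_mulr.
have eE2 : E2 = mu * T1.
  by apply: (mulfI S10); rewrite cross eE1; ring.
exists S, T, mu; split=> // w.
  have := congr1 (horner^~ w) eE1.
  by rewrite /= hornerM translateE hornerD !hornerM.
have := congr1 (horner^~ w) eE2.
by rewrite /= hornerM translateE hornerD !hornerM.
Qed.

Let far_bound w : 0 < p * w + a -> p * w + a + 1 <= r * w ->
  forall B : nat, `|q * w + b| <= B%:R -> `|F w| <= (1 - x) ^- B.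
Proof. by move=> h1 h2 B hB; apply: gauss_le => //; lra. Qed.

Section Line.
Variables S T mu : {poly R}.
Hypothesis Sn0 : S != 0.
Hypothesis line1 : forall w, (m11 N).[w] * S.[w] + (m12 N).[w] * T.[w] =
  mu.[w] * S.[w + 1].
Hypothesis line2 : forall w, (m21 N).[w] * S.[w] + (m22 N).[w] * T.[w] =
  mu.[w] * T.[w + 1].
Hypothesis far_rel : exists M, forall w, M <= w -> S.[w] * G w = T.[w] * F w.

Let k w := F w / S.[w].

Let far_k : exists M, forall w, M <= w -> [/\ S.[w] != 0, F w = k w * S.[w],
  G w = k w * T.[w], k w != 0 & D.[w] * k (w + 1) = mu.[w] * k w].
Proof.
have [M1 h1] := far_pos; have [M2 h2] := poly_far_neq0 Sn0.
have [M3 h3] := far_rel.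
exists (Num.max M1 (Num.max M2 M3)) => w; rewrite !ge_max => /andP[g1 /andP[g2 g3]].
have [Fp hr] := h1 w g1; have Sw := h2 w g2; have e := h3 w g3.
have w1 : w <= w + 1 by rewrite lerDl.
have Sw1 := h2 _ (le_trans g2 w1).
have eF : F w = k w * S.[w] by rewrite /k divfK.
have eG : G w = k w * T.[w].
  by apply: (mulfI Sw); rewrite e eF; ring.
split=> //; first by rewrite /k mulf_neq0 ?invr_eq0 // gt_eqF.
have [c1 _] := contig hr; apply: (mulIf Sw1).
rewrite -mulrA {1}/k divfK // c1 eF eG.
transitivity (k w * ((m11 N).[w] * S.[w] + (m12 N).[w] * T.[w])); first by ring.
by rewrite line1; ring.
Qed.

Let mu0 : mu != 0.
Proof.
have [M1 h1] := far_k; have [M2 h2] := poly_far_neq0 (splits_neq0 D0).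
pose w := Num.max M1 M2; apply: contra_neq (h2 w _) => [m0|]; last by rewrite le_max lexx orbT.
have hw : M1 <= w by rewrite le_max lexx.
have hw1 : M1 <= w + 1 by rewrite (le_trans hw) // lerDl.
have [_ _ _ _ e] := h1 w hw; have [_ _ _ kn _] := h1 (w + 1) hw1.
by apply/eqP; move/eqP: e; rewrite m0 horner0 mul0r mulf_eq0 (negPf kn) orbF.
Qed.

(** [k w] and [F w] grow at most exponentially, while [k (w + 1) / k w] is
    [mu / D]. *)
Let size_mu : (size mu <= size D)%N.
Proof.
rewrite leqNgt; apply/negP => sz.
pose E := (1 - x) ^- n2; have x1p : 0 < 1 - x by rewrite subr_gt0.
have E0 : 0 < E by rewrite invr_gt0 exprn_gt0.
have [M1 h1] := poly_dominates (2 * E) sz.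
have [M2 h2] := far_k; have [M3 h3] := poly_far_neq0 (splits_neq0 D0).
have [M4 h4] := far_par; have [M5 h5] := poly_far_ge Sn0.
pose w := Num.max (Num.max M1 M2) (Num.max M3 (Num.max M4 M5)).
have big j : [/\ M1 <= w + j%:R, M2 <= w + j%:R, M3 <= w + j%:R, M4 <= w + j%:R &
    M5 <= w + j%:R].
  have : w <= w + j%:R by rewrite lerDl ler0n.
  by rewrite {1}/w !ge_max => /andP[/andP[? ?] /and3P[? ? ?]].
have low j : (2 * E) ^+ j * `|k w| <= `|k (w + j%:R)|.
  elim: j => [|j IH]; first by rewrite expr0 mul1r addr0.
  have [g1 g2 g3 _ _] := big j; have [_ _ _ _ e] := h2 _ g2.
  have D1 : 0 < `|D.[w + j%:R]| by rewrite normr_gt0 h3.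
  have -> : w + j.+1%:R = w + j%:R + 1 by rewrite -addrA natr1.
  rewrite -(ler_pM2l D1) -normrM e (normrM mu.[_]) exprS.
  apply: (@le_trans _ _ (2 * E * `|D.[w + j%:R]| * `|k (w + j%:R)|)).
    have -> : `|D.[w + j%:R]| * (2 * E * (2 * E) ^+ j * `|k w|) =
      2 * E * `|D.[w + j%:R]| * ((2 * E) ^+ j * `|k w|) by ring.
    by rewrite ler_wpM2l // ltW // !mulr_gt0.
  by rewrite ler_wpM2r // h1.
pose B := Num.bound `|q * w + b|.
have up j : `|k (w + j%:R)| <= (1 - x) ^- B * E ^+ j / `|lead_coef S|.
  have [_ g2 _ g4 g5] := big j; have [Sw eF _ _ _] := h2 _ g2.
  have [a1 a2 _ _] := h4 _ g4.
  have l0 : 0 < `|lead_coef S| by rewrite normr_gt0 lead_coef_eq0.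
  rewrite ler_pdivlMr //; apply: (@le_trans _ _ `|F (w + j%:R)|).
    by rewrite eF (normrM (k _)) ler_wpM2l // h5.
  have hb : `|q * (w + j%:R) + b| <= (B + n2 * j)%:R.
    have -> : q * (w + j%:R) + b = (q * w + b) - (n2 * j)%:R by rewrite natrM /q; ring.
    rewrite (le_trans (ler_normB _ _)) // natrD normr_nat lerD2r ltW //.
    exact: archi_boundP.
  apply: le_trans (far_bound a1 a2 hb) _.
  by rewrite exprD invfM /E exprM exprVn.
have [_ _ _ kw _] : [/\ S.[w] != 0, F w = k w * S.[w],
  G w = k w * T.[w], k w != 0 & D.[w] * k (w + 1) = mu.[w] * k w].
  by apply: h2; have [_] := big 0%N; rewrite addr0.
have k0 : 0 < `|k w| by rewrite normr_gt0.
pose C := (1 - x) ^- B / `|lead_coef S| / `|k w|.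
have hC j : 2 ^+ j <= C.
  have := le_trans (low j) (up j).
  rewrite exprMn mulrAC -[leRHS]mulrA [E ^+ j / _]mulrC mulrA ler_pM2r ?exprn_gt0 //.
  by rewrite -ler_pdivlMr.
have := hC (Num.bound C).
have C0 : 0 <= C by apply: le_trans (hC 0%N); rewrite expr0.
apply/negP; rewrite -ltNge; apply: lt_le_trans (archi_boundP C0) _.
by rewrite -natrX ler_nat ltnW // ltn_expl.
Qed.

(** The proportionality of [(F, G)] and [(S, T)] goes down from [w + 1] to
    [w]. *)
Let descend_step w K : regular (r * w) -> (det2 N).[w] != 0 -> mu.[w] != 0 ->
  F (w + 1) = K * S.[w + 1] -> G (w + 1) = K * T.[w + 1] ->
  F w = K * D.[w] / mu.[w] * S.[w] /\ G w = K * D.[w] / mu.[w] * T.[w].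
Proof.
move=> hr hN hmu eF eG; have [c1 c2] := contig hr.
have l1 := line1 w; have l2 := line2 w; rewrite /det2 !hornerE in hN.
rewrite eF in c1; rewrite eG in c2.
pose u := mu.[w] * F w - K * D.[w] * S.[w].
pose v := mu.[w] * G w - K * D.[w] * T.[w].
have e1 : (m11 N).[w] * u + (m12 N).[w] * v = 0.
  transitivity (mu.[w] * ((m11 N).[w] * F w + (m12 N).[w] * G w) -
    K * D.[w] * ((m11 N).[w] * S.[w] + (m12 N).[w] * T.[w])).
    by rewrite /u /v; ring.
  by rewrite -c1 l1; ring.
have e2 : (m21 N).[w] * u + (m22 N).[w] * v = 0.
  transitivity (mu.[w] * ((m21 N).[w] * F w + (m22 N).[w] * G w) -
    K * D.[w] * ((m21 N).[w] * S.[w] + (m22 N).[w] * T.[w])).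
    by rewrite /u /v; ring.
  by rewrite -c2 l2; ring.
have hu : u = 0.
  apply: (mulfI hN); rewrite mulr0.
  transitivity ((m22 N).[w] * ((m11 N).[w] * u + (m12 N).[w] * v) -
    (m12 N).[w] * ((m21 N).[w] * u + (m22 N).[w] * v)); first by ring.
  by rewrite e1 e2 !mulr0 subrr.
have hv : v = 0.
  apply: (mulfI hN); rewrite mulr0.
  transitivity ((m11 N).[w] * ((m21 N).[w] * u + (m22 N).[w] * v) -
    (m21 N).[w] * ((m11 N).[w] * u + (m12 N).[w] * v)); first by ring.
  by rewrite e1 e2 !mulr0 subrr.
split; apply: (mulfI hmu).
  by move/eqP: hu; rewrite subr_eq0 => /eqP ->; field.
by move/eqP: hv; rewrite subr_eq0 => /eqP ->; field.
Qed.

Let descend (c d : R) J :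
  (forall j, (j < J)%N -> [/\ regular (r * (c + j%:R + d)),
     (det2 N).[c + j%:R + d] != 0 & mu.[c + j%:R + d] != 0]) ->
  forall K, F (c + J%:R + d) = K * S.[c + J%:R + d] ->
  G (c + J%:R + d) = K * T.[c + J%:R + d] ->
  let K' := K * (\prod_(j < J) D.[c + j%:R + d] / \prod_(j < J) mu.[c + j%:R + d]) in
  F (c + d) = K' * S.[c + d] /\ G (c + d) = K' * T.[c + d].
Proof.
elim: J => [|J IH] h K eF eG /=.
  by rewrite !big_ord0 divr1 mulr1; rewrite addr0 in eF eG.
have e : c + J.+1%:R + d = c + J%:R + d + 1 by rewrite -natr1; ring.
rewrite e in eF eG; have [h1 h2 h3] := h J (ltnSn J).
have [eF' eG'] := descend_step h1 h2 h3 eF eG.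
have [] := IH (fun j hj => h j (ltnW hj)) _ eF' eG'.
rewrite !big_ord_recr /= => -> ->; rewrite invfM; split; ring.
Qed.

(** At [c] with [q c + b > 0], the orders at [c] of the products of the
    translates of [mu] and of [D] govern the size of [(F, G)] at [c + d], to which
    [not_rightO] applies. *)
Let orders c J e : 0 < q * c + b -> order_cond e (p * c + a) (r * c) ->
  (forall w, c + J%:R <= w -> [/\ F w = k w * S.[w], G w = k w * T.[w],
     0 < p * w + a, p * w + a + 1 <= r * w & `|lead_coef S| <= `|S.[w]|]) ->
  (mup c (\prod_(j < J) translate mu j%:R) + e <=
   mup c (\prod_(j < J) translate D j%:R))%N -> False.
Proof.
move=> hb he hfar hmup.
pose DD := \prod_(j < J) translate D j%:R.
pose MM := \prod_(j < J) translate mu j%:R.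
have Dn := splits_neq0 D0.
have DD0 : DD != 0 by apply/prodf_neq0 => i _; rewrite translate_eq0.
have MM0 : MM != 0 by apply/prodf_neq0 => i _; rewrite translate_eq0.
have DDE d : DD.[c + d] = \prod_(j < J) D.[c + j%:R + d].
  by rewrite horner_prod; apply: eq_bigr => j _; rewrite translateE addrAC.
have MME d : MM.[c + d] = \prod_(j < J) mu.[c + j%:R + d].
  by rewrite horner_prod; apply: eq_bigr => j _; rewrite translateE addrAC.
have good : near0 (fun d => forall j, (j < J)%N ->
   [/\ regular (r * (c + j%:R + d)), (det2 N).[c + j%:R + d] != 0 &
       mu.[c + j%:R + d] != 0]).
  apply: near0_all => j _.
  have h1 := near0_regular r0 (r * (c + j%:R)).
  have h2 := near0_poly_neq0 (c + j%:R) detN0.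
  have h3 := near0_poly_neq0 (c + j%:R) mu0.
  apply: (near0_imp (near0I h1 (near0I h2 h3))) => d _ [g1 [g2 g3]].
  by split=> //; rewrite mulrDr.
have kO : rightO 0 (fun d => k (c + J%:R + d)).
  pose B := Num.bound (`|q * (c + J%:R) + b| + `|q|).
  exists ((1 - x) ^- B / `|lead_coef S|).
  apply: (near0_imp (near0_lt ltr01)) => d d0 d1.
  have hw : c + J%:R <= c + J%:R + d by rewrite lerDl ltW.
  have [eF _ a1 a2 hS] := hfar _ hw.
  have l0 : 0 < `|lead_coef S| by rewrite normr_gt0 lead_coef_eq0.
  rewrite expr0 mulr1 ler_pdivlMr //; apply: (@le_trans _ _ `|F (c + J%:R + d)|).
    by rewrite eF (normrM (k _)) ler_wpM2l.
  apply: far_bound => //.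
  have -> : q * (c + J%:R + d) + b = (q * (c + J%:R) + b) + q * d by ring.
  apply: le_trans (ler_normD _ _) _.
  apply: (@le_trans _ _ (`|q * (c + J%:R) + b| + `|q|)); last first.
    by rewrite ltW // archi_boundP // addr_ge0.
  by rewrite lerD2l normrM (gtr0_norm d0) ler_piMr // ltW.
have hK := rightO_quotient DD0 MM0 hmup.
have hkK := rightOMl kO hK.
have eq d : 0 < d -> (forall j, (j < J)%N ->
   [/\ regular (r * (c + j%:R + d)), (det2 N).[c + j%:R + d] != 0 &
       mu.[c + j%:R + d] != 0]) ->
  k (c + J%:R + d) * (DD.[c + d] / MM.[c + d]) * S.[c + d] =
    gauss x (near_par p q r (p * c + a) (q * c + b) (r * c) d) /\
  k (c + J%:R + d) * (DD.[c + d] / MM.[c + d]) * T.[c + d] =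
    gauss1 x (near_par p q r (p * c + a) (q * c + b) (r * c) d).
  move=> d0 hd.
  have hw : c + J%:R <= c + J%:R + d by rewrite lerDl ltW.
  have [eF eG _ _ _] := hfar _ hw.
  have [] := descend hd eF eG.
  rewrite DDE MME => <- <-.
  have -> : near_par p q r (p * c + a) (q * c + b) (r * c) d = zz (c + d).
    by rewrite /near_par /zz; congr (Par _ _ _); ring.
  by [].
apply: (@not_rightO R x p q r hx p0 r0 e (p * c + a) (q * c + b) (r * c)) => //.
  apply: (rightO_eq (near0_imp good (fun d d0 h => (eq d d0 h).1))).
  by rewrite -[e]addn0; apply: rightOM => //; exact: rightO_poly.
apply: (rightO_eq (near0_imp good (fun d d0 h => (eq d d0 h).2))).
by rewrite -[e]addn0; apply: rightOM => //; exact: rightO_poly.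
Qed.

(** [mu] has at least as many roots as [D] in each class modulo the integers, and
    strictly more in the class of a pole of [F]. *)
Lemma no_line : False.
Proof.
have [ts [c [cn0 eD]]] := D0.
have szD : size D = (size ts).+1 by rewrite eD size_scale // size_prod_XsubC.
have [M1 h1] := far_k; have [M2 h2] := far_par; have [M3 h3] := poly_far_ge Sn0.
pose Mx := Num.max M1 (Num.max M2 M3).
(* [L = - m] lies to the left of all the roots of [D], and of the zero of
   [q w + b] *)
pose bd := \sum_(t <- ts) `|t|.
have tbd t : t \in ts -> `|t| <= bd.
  move=> tt; rewrite /bd (big_rem t) //= lerDl; exact: sumr_ge0.
have bd0 : 0 <= bd by exact: sumr_ge0.
pose m := Num.bound (bd + `|b| + 2); pose L : R := - m%:R.
have hm : bd + `|b| + 2 < m%:R by rewrite archi_boundP // !addr_ge0.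
pose J := Num.bound (`|Mx| + m%:R + bd + 1).
have hJ : `|Mx| + m%:R + bd + 1 < J%:R by rewrite archi_boundP // !addr_ge0 // ler0n.
have hts t : t \in ts -> L <= t < L + J%:R.
  move=> /tbd; rewrite ler_norml => /andP[t1 t2]; rewrite /L.
  by have := normr_ge0 b; have := normr_ge0 Mx; lra.
have hb c' : L <= c' < L + 1 -> 0 < q * c' + b.
  move=> /andP[_ c2].
  have n1q : 1 <= - q by rewrite opprK ler1n.
  have : - c' <= - q * - c' by rewrite ler_peMl //; rewrite /L in c2; have := normr_ge0 b; lra.
  rewrite mulrNN; have := ler_norm (- b); rewrite normrN; rewrite /L in c2; lra.
have hfar c' : L <= c' -> forall w, c' + J%:R <= w -> [/\ F w = k w * S.[w],
   G w = k w * T.[w], 0 < p * w + a, p * w + a + 1 <= r * w &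
   `|lead_coef S| <= `|S.[w]|].
  move=> c1 w hw; have : Mx <= w.
    by have := ler_norm Mx; rewrite /L in c1; lra.
  rewrite !ge_max => /and3P[g1 g2 g3].
  have [_ -> -> _ _] := h1 w g1; have [? ? _ _] := h2 w g2.
  by split=> //; exact: h3.
have mupD c' : mup c' (\prod_(j < J) translate D j%:R) =
    (\sum_(j < J) count_mem (c' + j%:R)%R ts)%N.
  rewrite mup_translates ?(splits_neq0 D0) //; apply: eq_bigr => j _.
  rewrite eD -mul_polyC mupMr ?mu_prod_XsubC //.
  by rewrite rootC.
(* as [0 < p / r < 1], the values of [p w + a] at [L] and [L + 1 / r] are not
   both integers *)
have [c0 [hc0 he0]] : exists c0, L <= c0 < L + 1 /\
    order_cond 0 (p * c0 + a) (r * c0).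
  have m1 : (0 < m)%N by rewrite -(ltr0n R); have := normr_ge0 b; lra.
  have [hA|hA] := pselect (forall n : nat, p * L + a + n%:R != 0).
    exists L; split; first by rewrite lexx ltrDl ltr01.
    right; split=> //; split=> //; exists (n3 * m)%N.
    by rewrite /L /r natrM; ring.
  have {hA}[n /negP/negPn/eqP hn] : exists n : nat, ~ (p * L + a + n%:R != 0).
    by apply/existsNP.
  have r1 : 1 < r by rewrite /r ltr1n (leq_ltn_trans hn1).
  exists (L + r^-1); split.
    by rewrite lerDl invr_ge0 ler0n ltrD2l invf_lt1.
  right; split=> //; split.
    exists (n3 * m).-1; have nm : (0 < n3 * m)%N by rewrite muln_gt0 m1 (leq_ltn_trans _ hn13).
    have : ((n3 * m).-1)%:R = r * m%:R - 1 :> R.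
      by rewrite -natrM -(prednK nm) -natr1 /= addrK.
    by move=> ->; rewrite /L mulrDr mulfV //; ring.
  move=> n'; apply/eqP => e.
  have pq0 : 0 < p / r by rewrite divr_gt0.
  have pq1 : p / r < 1 by rewrite ltr_pdivrMr // mul1r.
  have e2 : p / r + n'%:R = n%:R.
    have : p * (L + r^-1) + a + n'%:R - (p * L + a + n%:R) = 0 by rewrite e hn subrr.
    by move=> e3; apply/eqP; rewrite -subr_eq0; apply/eqP; rewrite -e3; ring.
  have l1 : (n' < n)%N by rewrite -(ltr_nat R); lra.
  have l2 : (n < n'.+1)%N by rewrite -(ltr_nat R) -natr1; lra.
  by move: l2; rewrite ltnS leqNgt l1.
have := @count_roots R ts mu L J c0 mu0 hts _ hc0 _.
have main c' : L <= c' < L + 1 ->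
   (\sum_(j < J) count_mem (c' + j%:R)%R ts <= \sum_(j < J) mup (c' + j%:R)%R mu)%N.
  move=> hc'; rewrite leqNgt; apply/negP => hlt.
  have /andP[c1 _] := hc'.
  apply: (@orders c' J 1%N (hb _ hc') _ (hfar _ c1)); first by left.
  by rewrite mupD mup_translates // addn1.
have strict : (\sum_(j < J) count_mem (c0 + j%:R)%R ts <
   \sum_(j < J) mup (c0 + j%:R)%R mu)%N.
  rewrite ltnNge; apply/negP => hle; have /andP[c1 _] := hc0.
  apply: (@orders c0 J 0%N (hb _ hc0) he0 (hfar _ c1)).
  by rewrite mupD mup_translates // addn0.
move=> /(_ main strict) lt1; have := size_mu; rewrite szD.
by move: lt1; move: (size mu) (size ts) => [|u] v //= h1'; rewrite ltnS leqNgt h1'.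
Qed.

End Line.

Lemma no_rational_line : False.
Proof. by have [S [T [mu [h1 h2 h3 h4]]]] := line_exists; exact: (no_line h1 h2 h3 h4). Qed.

End Contradiction.

(** If [F (w + 1) / F w] is a rational function of [w], then the coefficient of
    [theta F] in the contiguity relation between [F w] and [F (w + 1)]
    vanishes. *)
Lemma rational_ratio_m12 (P Q : {poly R}) : Q != 0 ->
  (exists M, forall w, M <= w -> Q.[w] * F (w + 1) = P.[w] * F w) ->
  m12 unit_mx = 0.
Proof.
move=> Q0 hPQ; apply/eqP; apply: contraT => V0.
by case: (no_rational_line Q0 hPQ V0).
Qed.

End Rigidity.

(** * The functional equation of the Gamma function *)

(** If [g] diverges then so does [g'], and both limits are the default value
    0: the convergence of Gauss's product is not needed. *)
Lemma lim_ratio (K : numFieldType) (g g' h : nat -> K) (z : K) : z != 0 ->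
  (h @ \oo --> (0 : K))%classic -> (forall n, 1 + (z + 1) * h n != 0) ->
  (forall n, g' n * (1 + (z + 1) * h n) = g n * z) ->
  limn g' = z * limn g.
Proof.
move=> z0 h0 hn e.
have c1 : ((fun n => 1 + (z + 1) * h n) @ \oo --> (1 : K))%classic.
  rewrite -[X in (_ --> X)%classic]addr0 -[X in (_ --> _ + X)%classic](mulr0 (z + 1)).
  by apply: cvgD; [exact: cvg_cst|apply: cvgM => //; exact: cvg_cst].
have [/cvg_ex[l hl]|ng] := pselect (cvgn g).
  have -> : limn g = l by apply/cvg_lim.
  apply/cvg_lim => //.
  have -> : g' = (fun n => g n * z * (1 + (z + 1) * h n)^-1).
    by apply/funext => n; rewrite -e mulfK.
  rewrite [X in (_ --> X)%classic](_ : z * l = l * z * 1^-1); last by rewrite invr1 mulr1 mulrC.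
  apply: cvgM; first by apply: cvgM => //; exact: cvg_cst.
  by apply: cvgV => //; exact: oner_neq0.
have [/cvg_ex[l hl]|ng'] := pselect (cvgn g').
  exfalso; apply: ng; apply/cvg_ex; exists (l * 1 / z).
  have -> : g = (fun n => g' n * (1 + (z + 1) * h n) * z^-1).
    by apply/funext => n; rewrite e mulfK.
  by apply: cvgM; [exact: cvgM|exact: cvg_cst].
by rewrite (dvgP ng) (dvgP ng') /= mulr0.
Qed.

Section Gamma.
Variable R : realType.
Local Notation C := (Cplx R).

Lemma cexpD (u v : C) : cexp (u + v) = cexp u * cexp v.
Proof.
case: u => a b; case: v => c d; rewrite /cexp /= expRD cosD sinD.
by apply/eqP; rewrite eq_complex /=; apply/andP; split; apply/eqP; ring.
Qed.

Lemma cexp_ofR (a : R) : cexp (ofR a) = ofR (expR a).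
Proof. by rewrite /cexp /= cos0 sin0 mulr1 mulr0. Qed.

(** The [n]-th Gauss product. *)
Definition gauss_product (z : C) (n : nat) : C :=
  (n`!)%:R * cexp (z * ofR (ln n%:R)) / \prod_(0 <= k < n.+1) (z + k%:R).

Lemma gauss_productS (z : C) n : ~ nonpos_integer z ->
  gauss_product (z + 1) n.+1 * (1 + (z + 1) * ofR (n.+1%:R^-1)) =
  gauss_product z n.+1 * z.
Proof.
move=> hz; have hz' k : z + k%:R != 0.
  by apply/eqP => e; apply: hz; exists k; apply/eqP; rewrite -addr_eq0; apply/eqP.
rewrite /gauss_product mulrDl mul1r cexpD cexp_ofR lnK ?posrE ?ltr0n //.
have n0 : ofR (n.+1%:R) != 0 :> C by rewrite fmorph_eq0 pnatr_eq0.
have -> : ofR (n.+1%:R^-1) = (ofR n.+1%:R)^-1 :> C by rewrite fmorphV.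
pose Pr := \prod_(0 <= k < n.+1) (z + 1 + k%:R).
have e1 : \prod_(0 <= k < n.+2) (z + 1 + k%:R) = Pr * (z + 1 + n.+1%:R).
  by rewrite big_nat_recr.
have e2 : \prod_(0 <= k < n.+2) (z + k%:R) = z * Pr.
  rewrite big_nat_recl // addr0; congr (_ * _).
  by apply: eq_bigr => i _; rewrite -addrA nat1r.
have P0 : Pr != 0.
  by rewrite prodf_seq_neq0; apply/allP => i _ /=; rewrite -addrA nat1r; exact: hz'.
have z0 : z != 0 by have := hz' 0%N; rewrite addr0.
have l0 : z + 1 + n.+1%:R != 0 by rewrite -addrA nat1r.
have en : ofR n.+1%:R = n.+1%:R :> C by rewrite rmorph_nat.
rewrite e1 e2 en; rewrite en in n0; clear e1 e2 en.
move: (cexp _) (n.+1`!)%:R (Pr : C) P0 => E f P P0; move: (n.+1%:R : C) n0 l0 => m m0 l0.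
by field; rewrite m0 P0 z0 l0.
Qed.

Lemma GammaS (z : C) : ~ nonpos_integer z -> Gamma (z + 1) = z * Gamma z.
Proof.
move=> hz.
have z0 : z != 0 by apply/eqP => e; apply: hz; exists 0%N; rewrite e oppr0.
have limS (u : nat -> C) : limn u = limn (fun n => u n.+1).
  rewrite /lim; congr (get _); apply/funext => l; apply/propext.
  by rewrite -(cvg_shiftS u (nbhs l)).
rewrite /Gamma (limS (gauss_product (z + 1))) (limS (gauss_product z)).
apply: (@lim_ratio C _ _ (fun n => ofR (n.+1%:R^-1)) z z0).
- have -> : (0 : C) = ofR 0 by rewrite rmorph0.
  exact: cvg_ofR (@cvg_harmonic R).
- move=> n; have m0 : n.+1%:R != 0 :> C by rewrite pnatr_eq0.
  have -> : ofR (n.+1%:R^-1) = n.+1%:R^-1 :> C by rewrite fmorphV rmorph_nat.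
  apply/eqP => e; apply: hz; exists n.+2; apply/eqP; rewrite -addr_eq0; apply/eqP.
  have -> : z + n.+2%:R = (1 + (z + 1) * n.+1%:R^-1) * n.+1%:R.
    by rewrite mulrDl divfK // mul1r -(nat1r n.+1) addrA addrC.
  by rewrite e mul0r.
- by move=> n; exact: gauss_productS.
Qed.

End Gamma.

(** * Solutions and contiguity *)

Section RealParts.
Variable R : realType.
Local Notation C := (Cplx R).
Implicit Types (p : {poly C}) (w : R).

(** The real and imaginary parts of a complex polynomial, coefficientwise. *)
Definition poly_Re p : {poly R} := \poly_(i < size p) complex.Re p`_i.
Definition poly_Im p : {poly R} := \poly_(i < size p) complex.Im p`_i.

Lemma Re_mul_ofR (z : C) (y : R) : complex.Re (z * ofR y) = complex.Re z * y.
Proof. by case: z => a b /=; rewrite mulr0 subr0. Qed.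

Lemma Im_mul_ofR (z : C) (y : R) : complex.Im (z * ofR y) = complex.Im z * y.
Proof. by case: z => a b /=; rewrite mulr0 add0r. Qed.

Lemma Re_sum (I : Type) (s : seq I) (f : I -> C) :
  complex.Re (\sum_(i <- s) f i) = \sum_(i <- s) complex.Re (f i).
Proof. by apply: (big_morph (@complex.Re R)) => // -[? ?] [? ?]. Qed.

Lemma Im_sum (I : Type) (s : seq I) (f : I -> C) :
  complex.Im (\sum_(i <- s) f i) = \sum_(i <- s) complex.Im (f i).
Proof. by apply: (big_morph (@complex.Im R)) => // -[? ?] [? ?]. Qed.

Lemma horner_Re p w : complex.Re p.[ofR w] = (poly_Re p).[w].
Proof.
rewrite horner_poly horner_coef Re_sum; apply: eq_bigr => i _.
by rewrite -rmorphXn Re_mul_ofR.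
Qed.

Lemma horner_Im p w : complex.Im p.[ofR w] = (poly_Im p).[w].
Proof.
rewrite horner_poly horner_coef Im_sum; apply: eq_bigr => i _.
by rewrite -rmorphXn Im_mul_ofR.
Qed.

Lemma poly_Re_Im_neq0 p : p != 0 -> (poly_Re p != 0) || (poly_Im p != 0).
Proof.
move=> p0; rewrite -negb_and; apply: contra p0 => /andP[/eqP h1 /eqP h2].
apply/eqP/polyP => i; rewrite coef0; have [hi|hi] := ltnP i (size p); last exact: nth_default.
have := congr1 (fun q : {poly R} => q`_i) h1; have := congr1 (fun q : {poly R} => q`_i) h2.
by rewrite /= !coef_poly hi !coef0; case: (p`_i) => a b /= -> ->.
Qed.

End RealParts.

Section WeakSolutions.
Variable R : realType.
Local Notation C := (Cplx R).

(** The ratio is a rational function with real coefficients, for all large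
    real [w]. *)
Definition weak_solution (l : data R) : Prop :=
  exists P Q : {poly R}, Q != 0 /\ exists M, forall w, M <= w ->
    Q.[w] * gauss (dx l) (line_par l (w + 1)) = P.[w] * gauss (dx l) (line_par l w).

Lemma weak_of_complex (l : data R) (P Q : {poly C}) : 0 < dr l -> 0 < dx l < 1 ->
  Q != 0 -> (exists M, forall w : R, M <= w ->
    Q.[ofR w] * hypf l (ofR w + 1) = P.[ofR w] * hypf l (ofR w)) ->
  weak_solution l.
Proof.
move=> r0 hx Q0 [M hM]; have [M' hM'] := @far_line R (dr l) 0 1 r0.
have key : exists M, forall w : R, M <= w ->
   Q.[ofR w] * ofR (gauss (dx l) (line_par l (w + 1))) =
   P.[ofR w] * ofR (gauss (dx l) (line_par l w)).
  exists (Num.max M M') => w; rewrite ge_max => /andP[h1 /hM' h2].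
  have rw : 0 < dr l * w by lra.
  have rw1 : 0 < dr l * (w + 1) by lra.
  have := hM _ h1; have -> : ofR w + 1 = ofR (w + 1) :> C by rewrite rmorphD rmorph1.
  by rewrite !hypf_ofR //; exact: regular_gt0.
case/orP: (poly_Re_Im_neq0 Q0) => h; have [N hN] := key.
  exists (poly_Re P), (poly_Re Q); split=> //; exists N => w /hN e.
  by rewrite -!horner_Re -!Re_mul_ofR e.
exists (poly_Im P), (poly_Im Q); split=> //; exists N => w /hN e.
by rewrite -!horner_Im -!Im_mul_ofR e.
Qed.

(** By the functional equation of [Gamma], a gamma product formula gives a
    rational ratio. *)
Lemma problemI_weak (l : data R) : 0 < dr l -> 0 < dx l < 1 ->
  problemI l -> weak_solution l.
Proof.
move=> r0 hx [K [d [logd [m [n [u [v [K0 d0 hd hf]]]]]]]].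
pose P : {poly C} := d *: \prod_i ('X + (u i)%:P).
pose Q : {poly C} := \prod_j ('X + (v j)%:P).
have Q0 : Q != 0.
  by apply/prodf_neq0 => j _; rewrite -(opprK (v j)) polyCN polyXsubC_eq0.
apply: (@weak_of_complex l P Q) => //.
have [M' hM'] := @far_line R (dr l) 0 1 r0.
(* beyond [B] the numbers [w + u i] and [w + v j] have positive real parts *)
pose B := \sum_i normc (u i) + \sum_j normc (v j) + 1.
have notnp (w : R) (z : C) : normc z < w -> ~ nonpos_integer (ofR w + z).
  move=> hz [k /(congr1 (@complex.Re R))].
  rewrite -(rmorph_nat (@ofR R)); case: z hz => a b /= hz.
  have := normc_Re (a +i* b)%C => /=; rewrite ler_norml => /andP[h1 _] e.
  have k0 : 0 <= k%:R :> R by exact: ler0n.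
  lra.
have hu i : normc (u i) < B.
  have h1 : normc (u i) <= \sum_i normc (u i).
    by rewrite (bigD1 i) //= lerDl sumr_ge0 // => ? _; exact: normc_ge0.
  have h2 : 0 <= \sum_j normc (v j) by rewrite sumr_ge0 // => ? _; exact: normc_ge0.
  by rewrite /B; lra.
have hv j : normc (v j) < B.
  have h1 : normc (v j) <= \sum_j normc (v j).
    by rewrite (bigD1 j) //= lerDl sumr_ge0 // => ? _; exact: normc_ge0.
  have h2 : 0 <= \sum_j normc (u j) by rewrite sumr_ge0 // => ? _; exact: normc_ge0.
  by rewrite /B; lra.
exists (Num.max M' B) => w; rewrite ge_max => /andP[g1 g2].
have reg w' : M' <= w' -> regular_at l (ofR w').
  move=> /hM' h [k]; rewrite -rmorphM -(rmorph_nat (@ofR R)) -rmorphN.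
  by move=> /ofR_inj e; have := ler0n R k; lra.
have g1' : M' <= w + 1 by lra.
have e1 : ofR w + 1 = ofR (w + 1) :> C by rewrite rmorphD rmorph1.
have nu i : ~ nonpos_integer (ofR w + u i).
  by apply: notnp; apply: lt_le_trans g2.
have nv j : ~ nonpos_integer (ofR w + v j).
  by apply: notnp; apply: lt_le_trans g2.
have nu1 i : ~ nonpos_integer (ofR w + 1 + u i).
  by rewrite e1; apply: notnp; apply: (lt_le_trans (hu i)); lra.
have nv1 j : ~ nonpos_integer (ofR w + 1 + v j).
  by rewrite e1; apply: notnp; apply: (lt_le_trans (hv j)); lra.
have hf0 := hf _ (reg _ g1) nu nv; have hf1 := hf (ofR w + 1) _ nu1 nv1.
rewrite hf0 hf1; last by rewrite e1; exact: reg.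
have eu : \prod_i Gamma (ofR w + 1 + u i) =
    \prod_i (ofR w + u i) * \prod_i Gamma (ofR w + u i).
  rewrite -big_split; apply: eq_bigr => i _ /=.
  by rewrite addrAC GammaS.
have ev : \prod_j Gamma (ofR w + 1 + v j) =
    \prod_j (ofR w + v j) * \prod_j Gamma (ofR w + v j).
  rewrite -big_split; apply: eq_bigr => i _ /=.
  by rewrite addrAC GammaS.
have eP : P.[ofR w] = d * \prod_i (ofR w + u i).
  by rewrite /P hornerZ horner_prod; congr (_ * _); apply: eq_bigr => i _; rewrite !hornerE.
have eQ : Q.[ofR w] = \prod_j (ofR w + v j).
  by rewrite /Q horner_prod; apply: eq_bigr => i _; rewrite !hornerE.
have vn : \prod_j (ofR w + v j) != 0.
  apply/prodf_neq0 => j _; apply/eqP => e; apply: (nv j).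
  by exists 0%N; rewrite e oppr0.
rewrite eP eQ eu ev mulrDl mul1r cexpD hd invfM.
move: (\prod_j (ofR w + v j)) vn (\prod_i (ofR w + u i)) => A A0 A'.
move: (\prod_i _) ((\prod_j _)^-1) (cexp _) => G1 G2 E.
transitivity (K * (E * d) * (A' * G1) * G2 * (A * A^-1)); first by ring.
by rewrite divff // mulr1; ring.
Qed.

Lemma problemII_weak (l : data R) : 0 < dr l -> 0 < dx l < 1 ->
  (exists M, forall w, M <= w -> gauss (dx l) (line_par l w) != 0) ->
  problemII l -> weak_solution l.
Proof.
move=> r0 hx [M1 h1] [P [Q [Q0 hf]]]; apply: (@weak_of_complex l P Q) => //.
have [M2 h2] : exists M, forall w, M <= w -> Q.[ofR w] != 0.
  case/orP: (poly_Re_Im_neq0 Q0) => /poly_far_neq0[M hM]; exists M => w /hM.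
    by rewrite -horner_Re; apply: contra_neq => ->.
  by rewrite -horner_Im; apply: contra_neq => ->.
have [M' hM'] := @far_line R (dr l) 0 1 r0.
have reg w' : M' <= w' -> regular_at l (ofR w').
  move=> /hM' h [k]; rewrite -rmorphM -(rmorph_nat (@ofR R)) -rmorphN.
  by move=> /ofR_inj e; have := ler0n R k; lra.
exists (Num.max M' (Num.max M1 M2)) => w; rewrite !ge_max => /and3P[g1 g2 g3].
have hw0 : hypf l (ofR w) != 0.
  rewrite hypf_ofR //; first by rewrite fmorph_eq0; exact: h1.
  by apply: regular_gt0; have := hM' _ g1; lra.
have e1 : ofR w + 1 = ofR (w + 1) :> C by rewrite rmorphD rmorph1.
have reg1 : regular_at l (ofR w + 1) by rewrite e1; apply: reg; lra.
have := hf (ofR w) (reg _ g1) reg1 hw0 (h2 _ g3).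
by move/eqP; rewrite eqr_div ?h2 // => /eqP <-; rewrite mulrC.
Qed.

End WeakSolutions.

(** ** Integral data with [0 < p < r] and [q < 0] *)

Section IntegralData.
Variables (R : realType) (x a b : R) (n1 n2 n3 : nat).
Hypotheses (hx : 0 < x < 1) (hn1 : (0 < n1)%N) (hn13 : (n1 < n3)%N) (hn2 : (0 < n2)%N).
Local Notation C := (Cplx R).

(** The integral data with [p = n1], [q = - n2], [r = n3]. *)
Definition nat_data : data R := Data n1%:R (- n2%:R) n3%:R a b x.

Let r0 : 0 < n3%:R :> R. Proof. by rewrite ltr0n (ltn_trans hn1). Qed.

Lemma weak_m12 : weak_solution nat_data -> m12 (unit_mx x a b n1 n2 n3) = 0.
Proof.
by move=> [P [Q [Q0 h]]]; exact: (rational_ratio_m12 hx hn1 hn13 hn2 Q0 h).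
Qed.

Lemma solution_m12 : solution nat_data -> m12 (unit_mx x a b n1 n2 n3) = 0.
Proof.
move=> [h|h]; apply: weak_m12; first exact: problemI_weak.
apply: problemII_weak => //; have [M hM] := @far_pos R x a b n1 n2 n3 hx hn1 hn13 hn2.
by exists M => w /hM[h0 _]; rewrite gt_eqF.
Qed.

(** The relation without [theta F] holds at all complex [w]: the chain
    [unit_word] never lowers the third parameter. *)
Lemma m12_solution : m12 (unit_mx x a b n1 n2 n3) = 0 -> solution nat_data.
Proof.
move=> h; right.
have x1 : 1 - x != 0 by rewrite subr_eq0 gt_eqF //; case/andP: hx.
have x0 : x != 0 by rewrite gt_eqF //; case/andP: hx.
pose tC (p : {poly R}) : {poly C} := map_poly (@ofR R) p.
exists (tC (m11 (unit_mx x a b n1 n2 n3))), (tC (unit_den x a b n1 n2 n3)); split.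
  rewrite map_poly_eq0; apply: splits_neq0; apply: splits_dens => //.
  - by rewrite pnatr_eq0 -lt0n.
  - by rewrite oppr_eq0 pnatr_eq0 -lt0n.
  - by rewrite gt_eqF.
  - by rewrite subr_eq0 lt_eqF // ltr_nat.
  - by rewrite subr_eq0 lt_eqF // (@lt_trans _ _ 0) // oppr_lt0 ltr0n.
move=> w hw hw1 f0 Q0.
pose f : {rmorphism {poly R} -> C} := horner_eval w \o map_poly (@ofR R).
pose z := map_par f (unit_par a b n1 n2 n3).
have pz1 (p c : R) : f (p *: 'X + c%:P) = ofR p * w + ofR c.
  by rewrite /f /= /horner_eval rmorphD /= map_polyZ map_polyX map_polyC
    hornerD hornerZ hornerX hornerC.
have ez : z = Par (ofR n1%:R * w + ofR a) (ofR (- n2%:R) * w + ofR b) (ofR n3%:R * w).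
  rewrite /z /map_par; congr (Par _ _ _); try exact: pz1.
  by rewrite -[RHS]addr0 -(rmorph0 (@ofR R)); exact: pz1.
have regz : regular (pc z).
  rewrite ez /= => k; apply/eqP => e; apply: hw; exists k.
  by apply/eqP; rewrite -addr_eq0; apply/eqP.
have hS := fun z => @summable_gauss R x z hx.
have x1C : 1 - ofR x != 0 :> C by rewrite -(rmorph1 (@ofR R)) -rmorphB fmorph_eq0.
have := contiguity x1C hS (regulars_no_Sg (no_Sg_unit n1 n2 n3) regz).
have ex : f x%:P = ofR x by rewrite /f /= /horner_eval map_polyC hornerC.
rewrite -{1 2}ex -map_dens -map_mats -/(unit_den _ _ _ _ _ _) -/(unit_mx _ _ _ _ _ _).
have hm : m12 (map_mat2 f (unit_mx x a b n1 n2 n3)) = 0.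
  by rewrite -(rmorph0 f) -h.
move=> [+ _]; rewrite hm mul0r addr0.
have hE w' : hypf nat_data w' = gauss (ofR x : C)
  (Par (ofR n1%:R * w' + ofR a) (ofR (- n2%:R) * w' + ofR b) (ofR n3%:R * w')).
  exact: hypfE.
have ep : pshifts (unit_word n1 n2 n3) z = Par (ofR n1%:R * (w + 1) + ofR a)
    (ofR (- n2%:R) * (w + 1) + ofR b) (ofR n3%:R * (w + 1)).
  have cN : ofR n1%:R * w + ofR a + n1%:R = ofR n1%:R * (w + 1) + ofR a :> C.
    by rewrite rmorph_nat mulrDr mulr1 addrAC.
  have cN2 : ofR (- n2%:R) * w + ofR b - n2%:R = ofR (- n2%:R) * (w + 1) + ofR b :> C.
    by rewrite rmorphN rmorph_nat mulrDr mulr1 addrAC.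
  have cN3 : ofR n3%:R * w + n3%:R = ofR n3%:R * (w + 1) :> C.
    by rewrite rmorph_nat mulrDr mulr1.
  by rewrite pshifts_unit ez -cN -cN2 -cN3.
rewrite ep -hE ez -hE => e; apply/eqP; rewrite eqr_div //; apply/eqP.
by rewrite mulrC; exact: e.
Qed.

End IntegralData.

(** * Duality and reciprocity *)

Section Transfer.
Variable R : realType.

Lemma regulars_far (ws : seq step) (z : par R) : (size ws)%:R < pc z ->
  regulars ws z.
Proof.
elim: ws z => [|s ws IH] z /= h; first exact: regular_gt0.
rewrite -natr1 in h; have sz : 0 <= (size ws)%:R :> R by exact: ler0n.
split; first by apply: regular_gt0; lra.
by apply: IH; case: s => /=; lra.
Qed.

(** Any chain of steps from [w] to [w + 1] without a term in [theta F] shows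
    that the ratio is rational. *)
Lemma chain_weak (ws : seq step) (x a b : R) (n1 n2 n3 : nat) : 0 < x < 1 ->
  (0 < n1)%N -> (n1 < n3)%N -> (0 < n2)%N ->
  (forall z : par R, pshifts ws z = Par (pa z + n1%:R) (pb z - n2%:R) (pc z + n3%:R)) ->
  (forall w, m12 (mats x ws (Par (n1%:R * w + a) (- n2%:R * w + b) (n3%:R * w))) = 0) ->
  weak_solution (nat_data x a b n1 n2 n3).
Proof.
move=> hx hn1 hn13 hn2 hsh h0.
have x1 : 1 - x != 0 by rewrite subr_eq0 gt_eqF //; case/andP: hx.
have x0 : x != 0 by rewrite gt_eqF //; case/andP: hx.
have r0 : 0 < n3%:R :> R by rewrite ltr0n (ltn_trans hn1).
pose z := affine_par n1%:R (- n2%:R) n3%:R a b 0.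
exists (m11 (mats x%:P ws z)), (dens x%:P ws z); split.
  apply: splits_neq0; apply: splits_dens => //.
  - by rewrite pnatr_eq0 -lt0n.
  - by rewrite oppr_eq0 pnatr_eq0 -lt0n.
  - by rewrite gt_eqF.
  - by rewrite subr_eq0 lt_eqF // ltr_nat.
  - by rewrite subr_eq0 lt_eqF // (@lt_trans _ _ 0) // oppr_lt0 ltr0n.
have [M hM] := @far_line R n3%:R 0 ((size ws)%:R + 1) r0.
exists M => w /hM hw.
have hr : regulars ws (line_par (nat_data x a b n1 n2 n3) w).
  by apply: regulars_far => /=; lra.
have [+ _] := contiguity x1 (summable_gaussR hx) hr.
have -> : pshifts ws (line_par (nat_data x a b n1 n2 n3) w) =
    line_par (nat_data x a b n1 n2 n3) (w + 1).
  by rewrite hsh /line_par /=; congr (Par _ _ _); ring.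
have ez : line_par (nat_data x a b n1 n2 n3) w = map_par (horner_eval w) z.
  by rewrite affine_horner addr0.
have ex : x = horner_eval w x%:P by rewrite /horner_eval hornerC.
have -> : m12 (mats x ws (line_par (nat_data x a b n1 n2 n3) w)) = 0 by exact: h0.
have eD : dens x ws (line_par (nat_data x a b n1 n2 n3) w) = (dens x%:P ws z).[w].
  by rewrite ez {1}ex -map_dens.
have eN : m11 (mats x ws (line_par (nat_data x a b n1 n2 n3) w)) =
    (m11 (mats x%:P ws z)).[w].
  by rewrite ez {1}ex -map_mats.
by rewrite mul0r addr0 eD eN.
Qed.

Section Data.
Variables (x a b : R) (n1 n2 n3 : nat).
Hypotheses (hx : 0 < x < 1) (hn1 : (0 < n1)%N) (hn13 : (n1 < n3)%N) (hn2 : (0 < n2)%N).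

Let p : R := n1%:R.
Let q : R := - n2%:R.
Let r : R := n3%:R.
Let x1 : 1 - x != 0. Proof. by rewrite subr_eq0 gt_eqF //; case/andP: hx. Qed.
Let x0 : x != 0. Proof. by rewrite gt_eqF //; case/andP: hx. Qed.
Let p0 : p != 0. Proof. by rewrite pnatr_eq0 -lt0n. Qed.
Let q0 : q != 0. Proof. by rewrite oppr_eq0 pnatr_eq0 -lt0n. Qed.
Let rgt0 : 0 < r. Proof. by rewrite ltr0n (ltn_trans hn1). Qed.
Let r0 : r != 0. Proof. by rewrite gt_eqF. Qed.
Let pr : p - r != 0. Proof. by rewrite subr_eq0 lt_eqF // ltr_nat. Qed.
Let qr : q - r != 0.
Proof. by rewrite subr_eq0 lt_eqF // (@lt_trans _ _ 0) // oppr_lt0 ltr0n. Qed.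
Let nSg := no_Sg_unit n1 n2 n3.
Let uz := unit_par a b n1 n2 n3.

(** A vanishing polynomial coefficient vanishes at every real [w]. *)
Let eval_m12 (y : {poly R}) (y' : R) ws (z : par {poly R}) w :
  horner_eval w y = y' ->
  m12 (mats y ws z) = 0 -> m12 (mats y' ws (map_par (horner_eval w) z)) = 0.
Proof.
by move=> <- h; rewrite -map_mats -[RHS](rmorph0 (horner_eval w)) -h.
Qed.

(** At [2 / r - 1 - w], the dual of the chain from [w] to [w + 1] is a chain
    for the dual data. *)
Lemma dual_weak : m12 (unit_mx x a b n1 n2 n3) = 0 ->
  weak_solution (nat_data x (1 - 2 * p / r - a) (1 - 2 * q / r - b) n1 n2 n3).
Proof.
move=> h; apply: (@chain_weak (rev (unit_word n1 n2 n3))) => //.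
  move=> z; rewrite /unit_word !rev_cat !shifts_cat.
  by rewrite !rev_nseq !pshifts_nseq.
move=> w.
have hd := dual_m12 nSg _ (splits_neq0 (splits_dual_scalars x0 x1 p0 q0 r0 pr qr a b 0 nSg)) h.
have {}hd := hd (_ : 1 - x%:P != 0).
have x1P : 1 - x%:P != 0 :> {poly R} by rewrite -polyCB polyC_eq0.
have := eval_m12 (w := 2 / r - 1 - w) _ (hd x1P) => /(_ x).
rewrite {1}/horner_eval hornerC => /(_ erefl).
congr (m12 (mats x _ _) = 0).
have e : map_par (horner_eval (2 / r - 1 - w)) (dual_par (pshifts (unit_word n1 n2 n3) uz)) =
  dual_par (pshifts (unit_word n1 n2 n3) (map_par (horner_eval (2 / r - 1 - w)) uz)).
  by rewrite -map_pshifts /map_par /dual_par /= !rmorphB /= rmorph1 rmorph_nat.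
rewrite e pshifts_unit affine_horner /dual_par /=.
by congr (Par _ _ _); rewrite -/p -/q -/r; field.
Qed.

(* the natural number [r - p - q] *)
Let m3 : nat := (n3 - n1 + n2)%N.
Let rr : r - p - q = m3%:R.
Proof. by rewrite /m3 natrD natrB ?(ltnW hn13) // /r /p /q opprK. Qed.
Let rr0 : r - p - q != 0.
Proof. by rewrite rr pnatr_eq0 /m3 -lt0n addn_gt0 hn2 orbT. Qed.

(** The corresponding statement for the reciprocal data with [a] and [b]
    exchanged, at [w + (1 - a - b) / (r - p - q)]. *)
Lemma recip_weak : m12 (unit_mx x a b n1 n2 n3) = 0 ->
  weak_solution (nat_data (1 - x) (((r - p) * (1 - b) - q * a) / (r - p - q))
    (((r - q) * (1 - a) - p * b) / (r - p - q)) n2 n1 m3).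
Proof.
move=> h; apply: (@chain_weak (recip_word (unit_word n1 n2 n3))) => //.
- by case/andP: hx => g1 g2; apply/andP; split; lra.
- by rewrite /m3 -[X in (X < _)%N]add0n ltn_add2r subn_gt0.
- move=> z; pose a0 := 1 - pb z; pose b0 := 1 - pa z.
  have -> : z = recip_par (Par a0 b0 (pc z - 1 + a0 + b0)).
    by case: z @a0 @b0 => ? ? ? /=; rewrite /recip_par /=; congr (Par _ _ _); ring.
  rewrite recip_shifts // pshifts_unit /recip_par /=; congr (Par _ _ _).
  - by ring.
  - by ring.
  - by rewrite /m3 natrD natrB ?(ltnW hn13) //; ring.
move=> w; pose w0 := w - (1 - a - b) / (r - p - q).
have x1P : 1 - x%:P != 0 :> {poly R} by rewrite -polyCB polyC_eq0.
have hd := recip_m12 nSg x1P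
  (splits_neq0 (splits_recip_scalars2 p q0 r0 a b 0 nSg)) h.
have := eval_m12 (w := w0) _ hd => /(_ (1 - x)).
rewrite {1}/horner_eval -polyCB hornerC => /(_ erefl).
congr (m12 (mats (1 - x) _ _) = 0).
have e : map_par (horner_eval w0) (recip_par uz) = recip_par (map_par (horner_eval w0) uz).
  by rewrite /map_par /recip_par /= !(rmorphB, rmorphD) /= rmorph1.
rewrite e affine_horner /recip_par /= -rr /w0 -/p.
have -> : n2%:R = - q by rewrite opprK.
have rn := rr0; rewrite -?/p -?/q -?/r; move: p q r rn => p_ q_ r_ rn.
by congr (Par _ _ _); field.
Qed.

End Data.
End Transfer.

(** * The bijections *)

Section Bijections.
Variable R : realType.
Implicit Types l : data R.

Lemma pos_int_nat (y : R) : y \is a Num.int -> 0 < y ->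
  exists2 n : nat, (0 < n)%N & y = n%:R.
Proof.
move=> yi y0; have /natrP[n yn] : y \is a Num.nat by rewrite natrEint yi ltW.
by exists n => //; rewrite -(ltr0n R) -yn.
Qed.

Lemma Estarminus_nat l : Estarminus l -> integral_data l ->
  exists x a b n1 n2 n3, [/\ l = nat_data x a b n1 n2 n3, 0 < x < 1,
    (0 < n1)%N, (n1 < n3)%N & (0 < n2)%N].
Proof.
case: l => p q r a b x [/= /andP[p0 pr] q0 r0 hx] [/= pi qi ri].
have [n1 h1 e1] := pos_int_nat pi p0; have [n3 h3 e3] := pos_int_nat ri r0.
have nq0 : 0 < - q by rewrite oppr_gt0.
have nqi : - q \is a Num.int by rewrite rpredN.
have [n2 h2 e2] := pos_int_nat nqi nq0.
exists x, a, b, n1, n2, n3; split=> //; last by rewrite -(ltr_nat R) -e1 -e3.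
by rewrite /nat_data e1 e3 -e2 opprK.
Qed.

Lemma nat_data_Estarminus (x a b : R) (n1 n2 n3 : nat) : 0 < x < 1 ->
  (0 < n1)%N -> (n1 < n3)%N -> (0 < n2)%N ->
  Estarminus (nat_data x a b n1 n2 n3) /\ integral_data (nat_data x a b n1 n2 n3).
Proof.
move=> hx h1 h13 h2; split.
  split=> //=; rewrite ?oppr_lt0 ?ltr0n ?ltr_nat ?h1 //.
  exact: ltn_trans h1 h13.
by split; rewrite /= ?rpredN rpred_nat.
Qed.

Lemma duality_solution l : integral_solutions_in (@Estarminus R) l ->
  integral_solutions_in (@Estarminus R) (duality l).
Proof.
move=> [hE hi hs]; have [x [a [b [n1 [n2 [n3 [el hx h1 h13 h2]]]]]]] := Estarminus_nat hE hi.
subst l; have h0 := solution_m12 hx h1 h13 h2 hs.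
have w := dual_weak hx h1 h13 h2 h0.
have [hE' hi'] := nat_data_Estarminus (1 - 2 * n1%:R / n3%:R - a)
  (1 - 2 * - n2%:R / n3%:R - b) hx h1 h13 h2.
split=> //; apply: m12_solution => //.
exact: weak_m12.
Qed.

(** Exchange of the first two parameters of the series. *)
Definition exchange l : data R :=
  let: Data p q r a b x := l in Data q p r b a x.

Lemma hypf_exchange l w : hypf (exchange l) w = hypf l w.
Proof.
case: l => p q r a b x; rewrite /hypf /hyp2F1 /=.
apply: (f_equal (fun u : nat -> Cplx R => limn (series u))).
by apply/funext => n; rewrite [pochhammer (ofR q * w + _) n * _]mulrC.
Qed.

Lemma regular_exchange l w : regular_at (exchange l) w = regular_at l w.
Proof. by case: l. Qed.

Lemma solution_exchange l : solution l -> solution (exchange l).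
Proof.
move=> [[K [d [logd [m [n [u [v [h1 h2 h3 h4]]]]]]]]|[P [Q [Q0 h]]]].
  left; exists K, d, logd, m, n, u, v; split=> // w.
  by rewrite regular_exchange hypf_exchange; exact: h4.
right; exists P, Q; split=> // w.
by rewrite !regular_exchange !hypf_exchange; exact: h.
Qed.

Lemma exchangeK : involutive exchange.
Proof. by case. Qed.

Lemma integral_exchange l : integral_data l -> integral_data (exchange l).
Proof. by case: l => p q r a b x [h1 h2 h3]; split. Qed.

Lemma exchange_starminus l : Eminusstar l <-> Estarminus (exchange l).
Proof. by case: l => p q r a b x; split=> -[h1 h2 h3 h4]; split. Qed.

Lemma integral_solutions_exchange l :
  integral_solutions_in (@Eminusstar R) l <->
  integral_solutions_in (@Estarminus R) (exchange l).
Proof.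
split=> -[h1 h2 h3].
  by split; [apply/exchange_starminus|apply: integral_exchange|apply: solution_exchange].
split; first by apply/exchange_starminus.
  by rewrite -(exchangeK l); apply: integral_exchange.
by rewrite -(exchangeK l); apply: solution_exchange.
Qed.

Lemma reciprocity_exchange l : reciprocity (exchange l) = exchange (reciprocity l).
Proof.
case: l => p q r a b x; rewrite /reciprocity /exchange.
by congr (Data _ _ _ _ _ _); rewrite ?[r - q - p]addrAC.
Qed.

Lemma reciprocity_solution l : integral_solutions_in (@Estarminus R) l ->
  integral_solutions_in (@Eminusstar R) (reciprocity l).
Proof.
move=> [hE hi hs]; have [x [a [b [n1 [n2 [n3 [el hx h1 h13 h2]]]]]]] := Estarminus_nat hE hi.
apply/integral_solutions_exchange.
subst l; have h0 := solution_m12 hx h1 h13 h2 hs.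
have w := recip_weak hx h1 h13 h2 h0.
have hx' : 0 < 1 - x < 1 by case/andP: hx => g1 g2; apply/andP; split; lra.
have h13' : (n2 < n3 - n1 + n2)%N by rewrite -[X in (X < _)%N]add0n ltn_add2r subn_gt0.
have -> : exchange (reciprocity (nat_data x a b n1 n2 n3)) =
  nat_data (1 - x) (((n3%:R - n1%:R) * (1 - b) - - n2%:R * a) / (n3%:R - n1%:R - - n2%:R))
    (((n3%:R - - n2%:R) * (1 - a) - n1%:R * b) / (n3%:R - n1%:R - - n2%:R))
    n2 n1 (n3 - n1 + n2).
  rewrite /nat_data /=; congr (Data _ _ _ _ _ _); first by rewrite opprK.
  by rewrite natrD natrB ?(ltnW h13) // opprK.
have [hE' hi'] := nat_data_Estarminus
  (((n3%:R - n1%:R) * (1 - b) - - n2%:R * a) / (n3%:R - n1%:R - - n2%:R))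
  (((n3%:R - - n2%:R) * (1 - a) - n1%:R * b) / (n3%:R - n1%:R - - n2%:R))
  hx' h2 h13' h1.
split=> //; apply: m12_solution => //.
exact: weak_m12.
Qed.

Lemma reciprocity_solution_inv l : integral_solutions_in (@Eminusstar R) l ->
  integral_solutions_in (@Estarminus R) (reciprocity l).
Proof.
move=> /integral_solutions_exchange/reciprocity_solution.
by rewrite reciprocity_exchange => /integral_solutions_exchange; rewrite exchangeK.
Qed.

Lemma dualityK l : dr l != 0 -> duality (duality l) = l.
Proof.
by case: l => p q r a b x /= r0; rewrite /duality; congr (Data _ _ _ _ _ _); ring.
Qed.

Lemma reciprocityK l : dr l != 0 -> dr l - dp l - dq l != 0 ->
  reciprocity (reciprocity l) = l.
Proof.
case: l => p q r a b x /= r0 rr; rewrite /reciprocity.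
have e : r - p - q - - p - - q = r by ring.
congr (Data _ _ _ _ _ _); rewrite ?e ?opprK //.
- by field; rewrite rr r0.
- by field; rewrite rr r0.
- by ring.
Qed.

Lemma reciprocityK_starminus l : integral_solutions_in (@Estarminus R) l ->
  reciprocity (reciprocity l) = l.
Proof.
move=> [[/andP[p0 pr] q0 r0 _] _ _]; apply: reciprocityK; rewrite gt_eqF //; lra.
Qed.

Lemma reciprocityK_minusstar l : integral_solutions_in (@Eminusstar R) l ->
  reciprocity (reciprocity l) = l.
Proof.
move=> [[p0 /andP[q0 qr] r0 _] _ _]; apply: reciprocityK; rewrite gt_eqF //; lra.
Qed.

Lemma set_bij_inv (T : Type) (A B : set T) (f : T -> T) :
  (forall y, A y -> B (f y)) -> (forall y, B y -> A (f y)) ->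
  (forall y, A y -> f (f y) = y) -> (forall y, B y -> f (f y) = y) ->
  set_bij A B f.
Proof.
move=> hAB hBA hA hB; split.
- by move=> y; exact: hAB.
- by move=> y z; rewrite !inE => /hA ey /hA ez e; rewrite -ey e ez.
- by move=> y By; exists (f y); [exact: hBA|exact: hB].
Qed.

End Bijections.

Theorem theorem2p7 (R : realType) :
  set_bij (integral_solutions_in (@Estarminus R))
          (integral_solutions_in (@Estarminus R))
          (@duality R) /\
  set_bij (integral_solutions_in (@Estarminus R))
          (integral_solutions_in (@Eminusstar R))
          (@reciprocity R).
Proof.
have dK l : integral_solutions_in (@Estarminus R) l -> duality (duality l) = l.
  by move=> [[_ _ r0 _] _ _]; apply: dualityK; rewrite gt_eqF.
split; apply: set_bij_inv => //.
- exact: duality_solution.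
- exact: duality_solution.
- exact: reciprocity_solution.
- exact: reciprocity_solution_inv.
- exact: reciprocityK_starminus.
- exact: reciprocityK_minusstar.
Qed.
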